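(* Assume the standing hypotheses on the continuous problem and on the space discretization listed in the context. Assume also that $\partial u\neq0$ (the boundary data $g$ does not vanish), that $c_1<c_2<\dots<c_s$, that $c_i\ne1$ for $i=1,\dots,s$, and that there exist $C'$, $h_0$ such that $$\|\tau A_{h,0}e^{\tau A_{h,0}}\|_h\le C',\qquad \tau\ge0,\ h\le h_0.$$ If moreover $u\in C^2([0,T],X)$ and there is a constant $C$ (independent of $h$, $k$, $n$) with $$\Big\|kA_{h,0}\sum_{r=1}^{n-1}e^{rkA_{h,0}}\Big\|_h\le C,\qquad 0\le nk\le T,$$ then the global error of the classical Lawson full discretization satisfies $e_{h,n}=U_h^n-P_hu(t_n)=O(1)$.
   Context: **Continuous problem.** $\Omega\subset\mathbb R^d$ is a bounded domain, $X=C(\overline\Omega)$ with the maximum norm, $Y$ is a Banach space, $A:D(A)\subset X\to X$ and $\partial:D(A)\to Y$ are linear. $u$ is the solution of $u'(t)=Au(t)+f(t,u(t))$, $0\le t\le T$, $u(0)=u_0\in X$, $\partial u(t)=g(t)\in Y$, with $f:[0,T]\times X\to X$ (in general nonlinear) and $g:[0,T]\to Y$. *Standing hypotheses on the continuous problem:* (i) $\partial:D(A)\to Y$ is onto and $g\in C^1([0,T],Y)$. (ii) $\ker\partial$ is dense in $X$ and $A_0$, the restriction of $A$ to $D(A_0)=\ker\partial$, generates a $C_0$-semigroup $\{e^{tA_0}\}_{t\ge0}$ on $X$ of negative type $\omega$. (iii) For $\Re z>0$ and $v\in Y$ the problem $Ax=zx$, $\partial x=v$ has a unique solution $x=K(z)v$,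 and $\|K(z)v\|\le C\|v\|$ with $C$ uniform for $\Re z\ge\omega_0>\omega$. (iv) $f\in C^1([0,T]\times X,X)$. (v) $u\in C^1([0,T],X)$, $u(t)\in D(A)$ for all $t\in[0,T]$, $Au\in C([0,T],X)$. **Space discretization.** For a mesh parameter $h$, $\Omega_h$ is a grid with $N$ nodes; $\|\cdot\|_h$ is the maximum norm on $\mathbb C^N$ (and the induced operator norms); $P_h:X\to\mathbb C^N$ maps a function to its values on the grid; $A_{h,0}$ is an $N\times N$ matrix (discretizing $A_0$) and $C_h:Y\to\mathbb C^N$ is linear, so that $A$ acting on functions with $\partial u=g$ is discretized by $A_{h,0}U_h+C_hg$. The function $f$ also makes sense as a map $[0,T]\times\mathbb C^N\to\mathbb C^N$ and $P_hf(t,u)=f(t,P_hu)$ for $t\in[0,T]$, $u\in X$. *Standing hypotheses on the discretization:* (a) $\|e^{tA_{h,0}}\|_h\le1$ for $t\ge0$; $A_{h,0}$ is invertible and $\|A_{h,0}^{-1}\|_h\le C$ with $C$ independent of $h$. (b) Let $R_h:D(A)\to\mathbb C^N$ be defined by $A_{h,0}R_hu+C_h\partial u=P_hAu$. There is a subspace $Z\subset D(A)$ with norm $\|\cdot\|_Z$ such that for $u\in Z$: $A_0^{-1}u\in Z$ and $e^{tA_0}u,f(t,u)\in Z$ for $t\in[0,T]$; $\|A_{h,0}(P_hu-R_hu)\|_h\le\varepsilon_h\|u\|_Z$ and $\|P_hu-R_hu\|_h\le\eta_h\|u\|_Z$, with $\varepsilon_h,\eta_h$ small with $h$. Moreover $\|A_{h,0}^{-1}C_h\|_h\le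 C''$ with $C''$ independent of $h$. (c) $f\in C^1([0,T]\times\mathbb C^N,\mathbb C^N)$ and its derivative with respect to the variable in $\mathbb C^N$ is uniformly bounded in a neighbourhood of the solution where the numerical approximation stays. **Classical Lawson discretization (first space, then time).** Let $a_{ij}$ ($j<i$), $b_i$, $c_i$ ($1\le i\le s$) be the coefficients of an explicit Runge–Kutta tableau, with $0\le c_i\le 1$. Let $k>0$ be the time stepsize, $t_n=nk\le T$. Starting from $U_h^0=P_hu(0)$, define for $i=1,\dots,s$ $$K_{h,i}^n=e^{c_ikA_{h,0}}U_h^n+k\sum_{j=1}^{i-1}a_{ij}e^{(c_i-c_j)kA_{h,0}}[C_hg(t_n+c_jk)+f(t_n+c_jk,K^n_{h,j})],$$ $$U_h^{n+1}=e^{kA_{h,0}}U_h^n+k\sum_{i=1}^sb_ie^{(1-c_i)kA_{h,0}}[C_hg(t_n+c_ik)+f(t_n+c_ik,K_{h,i}^n)].$$ All $O(\cdot)$ bounds are in $\|\cdot\|_h$, with constants independent of $k$, (small) $h$ and $n$ with $nk\le T$. *)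

(* Defs.v *)
From HB Require Import structures.
From mathcomp Require Import all_boot all_order all_algebra.
From mathcomp Require Import all_classical all_reals all_analysis.
From mathcomp Require Import complex.

Set Implicit Arguments.
Unset Strict Implicit.
Unset Printing Implicit Defensive.

Import Order.TTheory GRing.Theory Num.Theory.
Import numFieldNormedType.Exports.

Local Open Scope classical_set_scope.
Local Open Scope ring_scope.
Local Open Scope complex_scope.

(* The norm of a [normedModType R[i]] is an element of R[i] with zero imaginary
   part; [nrm] is the same number, as an element of R. *)
Definition nrm (R : realType) (V : normedModType R[i]) (x : V) : R :=
  complex.Re `|x|.

Section nrm_theory.
Variables (R : realType) (V : normedModType R[i]).
Implicit Types x y : V.

Lemma nrmE x : `|x| = (nrm x)%:C.
Proof. by rewrite /nrm RRe_real ?ger0_real. Qed.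

Lemma nrm_ge0 x : 0 <= nrm x.
Proof. by rewrite -lecR -nrmE; exact: normr_ge0. Qed.

Lemma nrmD x y : nrm (x + y) <= nrm x + nrm y.
Proof. by rewrite -lecR rmorphD/= -!nrmE ler_normD. Qed.

Lemma nrmZ (a : R[i]) x : nrm (a *: x) = complex.Re `|a| * nrm x.
Proof. by rewrite {1}/nrm normrZ nrmE normc_def /= mul0r subr0. Qed.

Lemma nrm_continuous : continuous (@nrm R V).
Proof.
move=> x; apply/cvgrPdist_lt => e e0; near=> y.
have xy : nrm (x - y) < e.
  rewrite -ltcR -nrmE; near: y.
  by apply: cvgr_dist_lt; [exact: cvg_id|rewrite ltcR].
apply: le_lt_trans xy; rewrite ler_norml; apply/andP; split.
  rewrite lerNl opprB lerBlDr -{1}(subrK x y).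
  by apply: le_trans (nrmD _ _) _; rewrite /nrm distrC.
by rewrite lerBlDr -{1}(subrK y x) nrmD.
Unshelve. all: by end_near. Qed.

Lemma nrm0_eq0 x : nrm x = 0 -> x = 0.
Proof. by move=> h; apply/normr0_eq0; rewrite nrmE h. Qed.

End nrm_theory.

Record domain (R : realType) (d : nat) := Domain {
  dom_set :> set 'rV[R]_d ;
  dom_nonempty : dom_set !=set0 ;
  dom_open : open dom_set ;
  dom_connected : connected dom_set ;
  dom_bounded : bounded_set dom_set }.

Section continuous_functions.
Variables (R : realType) (d : nat) (Om : domain R d).

Definition contC : {pred (closure Om -> R[i]^o)} :=
  [pred f | `[< continuous f >]].

Record Ccl := MkCcl { Ccl_fun :> closure Om -> R[i]^o ; _ : Ccl_fun \in contC }.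

HB.instance Definition _ := [isSub for Ccl_fun].
HB.instance Definition _ := [Choice of Ccl by <:].

Lemma contCP (f : closure Om -> R[i]^o) : reflect (continuous f) (f \in contC).
Proof. exact: asboolP. Qed.

Lemma contC_submod : submod_closed contC.
Proof.
split=> [|a f g /contCP fc /contCP gc]; apply/contCP => x.
  exact: (@cvg_cst _ _ _ (nbhs x)).
exact: (cvgD (cvgZl_tmp (k := a) (fc x)) (gc x)).
Qed.

HB.instance Definition _ := GRing.isSubmodClosed.Build _ _ contC contC_submod.
HB.instance Definition _ := [SubChoice_isSubLmodule of Ccl by <:].


Lemma closure_compact : compact (closure Om).
Proof.
apply: bounded_closed_compact; last exact: closed_closure.
have [B B0 OmB] := pinfty_ex_gt0 (dom_bounded Om).
exists B; split=> [|N BN x clx]; first exact: gtr0_real.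
apply: le_trans (ltW BN).
have : closed_ball (0 : 'rV[R]_d) B x.
  rewrite (closure_id (closed_ball _ _)).1; last exact: closed_ball_closed.
  apply: closureS clx => y /OmB yB.
  by rewrite closed_ballE // /closed_ball_ /= sub0r normrN.
by rewrite closed_ballE // /closed_ball_ /= sub0r normrN.
Qed.

Lemma Ccl_continuous (f : Ccl) : continuous (f : closure Om -> R[i]^o).
Proof. by case: f => f fC; exact/contCP. Qed.

Lemma Ccl_bounded (f : Ccl) : has_sup (range (fun x => nrm (f x))).
Proof.
split.
  have [x Omx] := dom_nonempty Om.
  have clx : x \in closure Om by rewrite inE; exact: subset_closure.
  by exists (nrm (f (exist _ x clx))); exists (exist _ x clx).
have cf : {within closure Om, continuous (valL (fun x => nrm (f x)))}.
  apply/subspace_valL_continuousP => x.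
  by apply: continuous_comp; [exact: Ccl_continuous|exact: nrm_continuous].
have := compact_bounded (continuous_compact cf closure_compact :
  compact (_ : set R^o)).
move=> /pinfty_ex_gt0[B B0 fB]; exists B => _ [x _ <-].
apply: le_trans (ler_norm _) _; apply: fB; exists (set_val x).
  by case: x => x xP; exact: set_mem xP.
exact: (congr1 (@^~ x) (valLK point (fun x => nrm (f x)))).
Qed.

Lemma nrm_le_sup (f : Ccl) x : nrm (f x) <= sup (range (fun x => nrm (f x))).
Proof. by apply: sup_ubound; [have [] := Ccl_bounded f|exists x]. Qed.

Definition sup_norm (f : Ccl) : R[i] := (sup (range (fun x => nrm (f x))))%:C.

Lemma sup_normD f g : sup_norm (f + g) <= sup_norm f + sup_norm g.
Proof.
rewrite /sup_norm -rmorphD/= lecR; apply: ge_sup.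
  by have [] := Ccl_bounded (f + g).
move=> _ [x _ <-]; apply: le_trans (nrmD _ _) _.
by apply: lerD; exact: nrm_le_sup.
Qed.

Lemma sup_norm_ge0 f : 0 <= sup_norm f.
Proof.
rewrite lecR; have [[_ [x _ _]] _] := Ccl_bounded f.
exact: le_trans (nrm_ge0 (f x)) (nrm_le_sup f x).
Qed.

Lemma sup_normZ_le (a : R[i]) f : sup_norm (a *: f) <= `|a| * sup_norm f.
Proof.
have -> : `|a| = (complex.Re `|a|)%:C by rewrite RRe_real ?ger0_real.
rewrite /sup_norm -rmorphM/= lecR; apply: ge_sup.
  by have [] := Ccl_bounded (a *: f).
move=> _ [x _ <-]; rewrite nrmZ ler_wpM2l ?nrm_le_sup //.
exact: (@nrm_ge0 _ R[i]^o a).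
Qed.

Lemma sup_normZ (a : R[i]) f : sup_norm (a *: f) = `|a| * sup_norm f.
Proof.
apply/eqP; rewrite eq_le sup_normZ_le /=.
have [->|a0] := eqVneq a 0; first by rewrite normr0 mul0r sup_norm_ge0.
rewrite -{1}(scalerK a0 f).
apply: le_trans (ler_wpM2l (normr_ge0 a) (sup_normZ_le _ _)) _.
by rewrite mulrA normfV divff ?normr_eq0 // mul1r.
Qed.

Lemma sup_norm0_eq0 f : sup_norm f = 0 -> f = 0.
Proof.
move=> /complexI f0; apply/val_inj/funext => x /=.
apply: nrm0_eq0; apply/eqP; rewrite eq_le nrm_ge0 andbT.
by rewrite -f0; exact: nrm_le_sup.
Qed.

HB.instance Definition _ :=
  @Lmodule_isNormed.Build R[i] Ccl sup_norm sup_normD sup_normZ sup_norm0_eq0.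

End continuous_functions.

Section operators.
Variables (R : realType) (V W : normedModType R[i]).

(* Valued in \bar R, so that an unbounded operator has norm +oo. *)
Definition opnorm (L : V -> W) : \bar R :=
  ereal_sup [set (nrm (L x))%:E | x in [set x | nrm x <= 1]].

Definition subspace_set (D : set V) : Prop :=
  D 0 /\ forall (a : R[i]) x y, D x -> D y -> D (a *: x + y).

Definition linear_on (D : set V) (L : V -> W) : Prop :=
  forall (a : R[i]) x y, D x -> D y -> L (a *: x + y) = a *: L x + L y.

End operators.

Section differentiability.
Variables (R : realType) (T : R).
Let I : set R := `[0, T].

(* One-sided at the end points of [0, T]. *)
Definition is_deriv_on (E : normedModType R[i]) (u du : R -> E) : Prop :=
  forall t, I t ->
    ((s - t)^-1)%:C *: (u s - u t) @[s --> within I t^'] --> du t.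

Definition C1_on (E : normedModType R[i]) (u : R -> E) : Prop :=
  exists2 du, is_deriv_on u du & {within I, continuous du}.

Definition C2_on (E : normedModType R[i]) (u : R -> E) : Prop :=
  exists2 du, is_deriv_on u du & C1_on du.

(* [f] is C^1 on [0, T] x E, with Frechet derivative
   (tau, v) |-> tau *: Dt t x + Dx t x v at (t, x). E and F are regarded as real
   Banach spaces: Dx t x is only required to be R-linear. *)
Record is_C1_with (E F : normedModType R[i]) (f : R -> E -> F)
    (Dt : R -> E -> F) (Dx : R -> E -> E -> F) : Prop := {
  C1_linear : forall t x, I t -> forall (a : R) v w,
    Dx t x (a%:C *: v + w) = a%:C *: Dx t x v + Dx t x w ;
  C1_bounded : forall t x, I t -> (opnorm (Dx t x) < +oo)%E ;
  C1_frechet : forall t x, I t -> forall e : R, 0 < e ->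
    \forall q \near within (I `*` setT) (nbhs (t, x)),
      nrm (f q.1 q.2 - f t x
           - ((q.1 - t)%:C *: Dt t x + Dx t x (q.2 - x)))
      <= e * (`|q.1 - t| + nrm (q.2 - x)) ;
  C1_Dt_continuous : {within I `*` setT, continuous (fun q => Dt q.1 q.2)} ;
  C1_Dx_continuous : forall t x, I t ->
    opnorm (fun v => Dx q.1 q.2 v - Dx t x v)
      @[q --> within (I `*` setT) (nbhs (t, x))] --> 0%E }.

Definition C1_map (E F : normedModType R[i]) (f : R -> E -> F) : Prop :=
  exists Dt Dx, is_C1_with f Dt Dx.

End differentiability.

Section semigroups.
Variables (R : realType) (X : normedModType R[i]) (S : R -> X -> X).

Record C0_semigroup : Prop := {
  sg_linear : forall t, 0 <= t -> linear_on setT (S t) ;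
  sg_bounded : forall t, 0 <= t -> (opnorm (S t) < +oo)%E ;
  sg_0 : forall x, S 0 x = x ;
  sg_D : forall s t x, 0 <= s -> 0 <= t -> S (s + t) x = S s (S t x) ;
  sg_continuous : forall x, S t x @[t --> 0^'+] --> x }.

Definition generated_by (D : set X) (A : X -> X) : Prop :=
  forall x y, (D x /\ A x = y) <->
    (t^-1)%:C *: (S t x - x) @[t --> 0^'+] --> y.

(* The growth bound; -oo is possible. *)
Definition semigroup_type : \bar R :=
  ereal_inf [set w%:E | w in [set w : R | exists M : R,
    forall t, 0 <= t -> (opnorm (S t) <= (M * expR (w * t))%:E)%E]].

End semigroups.

Section continuous_problem.
Variables (R : realType) (d : nat) (Om : domain R d).
Local Notation X := (Ccl Om).
Variables (Y : completeNormedModType R[i]) (T : R).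
Variables (DA : set X) (A : X -> X) (bd : X -> Y).
Variables (f : R -> X -> X) (g : R -> Y) (u0 : X) (u : R -> X).
(* [S t] is exp(t A_0). *)
Variable S : R -> X -> X.
Let I : set R := `[0, T].

Definition ker_bd : set X := [set x | DA x /\ bd x = 0].

Record continuous_problem : Prop := {
  cp_T : 0 < T ;
  cp_DA : subspace_set DA ;
  cp_A_linear : linear_on DA A ;
  cp_bd_linear : linear_on DA bd ;
  cp_bd_onto : forall v, exists2 x, DA x & bd x = v ;
  cp_g_C1 : C1_on T g ;
  cp_ker_dense : dense ker_bd ;
  cp_semigroup : C0_semigroup S ;
  cp_generator : generated_by S ker_bd A ;
  cp_negative_type : (semigroup_type S < 0)%E ;
  cp_K : forall (z : R[i]) v, 0 < complex.Re z ->
    exists! x, [/\ DA x, A x = z *: x & bd x = v] ;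
  (* K(z) v is the x below; for Re z > 0 it is the one given by [cp_K]. *)
  cp_K_bounded : exists w0 C : R, (semigroup_type S < w0%:E)%E /\
    forall (z : R[i]) v x, w0 <= complex.Re z ->
      DA x -> A x = z *: x -> bd x = v -> nrm x <= C * nrm v ;
  cp_f_C1 : C1_map T f ;
  cp_u_C1 : C1_on T u ;
  cp_u_DA : forall t, I t -> DA (u t) ;
  cp_Au_continuous : {within I, continuous (A \o u)} ;
  cp_equation : is_deriv_on T u (fun t => A (u t) + f t (u t)) ;
  cp_initial : u 0 = u0 ;
  cp_boundary : forall t, I t -> bd (u t) = g t }.

End continuous_problem.

Section matrices.
Variables (R : realType) (n : nat).

Definition expmx (A : 'M[R[i]]_n) : 'M[R[i]]_n :=
  lim (series (fun m => (m`!%:R)^-1 *: A ^+ m) @ \oo).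

(* The norm of ['cV_n] is the maximum norm; this is the induced one. *)
Definition mx_opnorm (A : 'M[R[i]]_n) : \bar R :=
  opnorm (mulmx A : 'cV[R[i]]_n -> 'cV[R[i]]_n).

End matrices.

Definition grid_values (R : realType) (d : nat) (Om : domain R d) (N : nat)
    (node : 'I_N -> closure Om) (v : Ccl Om) : 'cV[R[i]]_N :=
  \col_i v (node i).

Section discretization.
Variables (R : realType) (d : nat) (Om : domain R d).
Local Notation X := (Ccl Om).
Variables (Y : completeNormedModType R[i]) (T : R).
Variables (DA : set X) (A : X -> X) (bd : X -> Y) (f : R -> X -> X).
Variable S : R -> X -> X.
(* [H] is the set of mesh parameters in use. *)
Variables (H : set R) (N : R -> nat) (node : forall h, 'I_(N h) -> closure Om).
Variables (Ah : forall h, 'M[R[i]]_(N h)).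
Variables (Ch : forall h, {linear Y -> 'cV[R[i]]_(N h)}).
Variables (fh : forall h, R -> 'cV[R[i]]_(N h) -> 'cV[R[i]]_(N h)).
Variables (Rh : forall h, X -> 'cV[R[i]]_(N h)).
Variables (Z : set X) (normZ : X -> R) (eps eta : R -> R).
Let I : set R := `[0, T].
Local Notation P h := (grid_values (@node h)).

Record is_norm_on : Prop := {
  normZ_ge0 : forall x, Z x -> 0 <= normZ x ;
  normZ_eq0 : forall x, Z x -> normZ x = 0 -> x = 0 ;
  normZ_Z : forall (a : R[i]) x, Z x ->
    normZ (a *: x) = complex.Re `|a| * normZ x ;
  normZ_D : forall x y, Z x -> Z y -> normZ (x + y) <= normZ x + normZ y }.

Record space_discretization : Prop := {
  sd_H_gt0 : forall h, H h -> 0 < h ;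
  sd_H_small : forall e, 0 < e -> exists2 h, H h & h < e ;
  sd_node_inj : forall h, H h -> injective (@node h) ;
  sd_f : forall h, H h -> forall t v, I t -> P h (f t v) = fh t (P h v) ;
  sd_contractive : forall h, H h -> forall t, 0 <= t ->
    (mx_opnorm (expmx (t%:C *: Ah h)) <= 1)%E ;
  sd_unit : forall h, H h -> Ah h \in unitmx ;
  sd_inv : exists C : R, forall h, H h -> (mx_opnorm (invmx (Ah h)) <= C%:E)%E ;
  sd_R : forall h, H h -> forall v, DA v ->
    Ah h *m Rh h v + Ch h (bd v) = P h (A v) ;
  sd_Z : subspace_set Z ;
  sd_Z_DA : Z `<=` DA ;
  sd_normZ : is_norm_on ;
  sd_Z_inv : forall v, Z v -> exists2 w, Z w & ker_bd DA bd w /\ A w = v ;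
  sd_Z_S : forall v t, Z v -> I t -> Z (S t v) ;
  sd_Z_f : forall v t, Z v -> I t -> Z (f t v) ;
  sd_eps : forall h, H h -> forall v, Z v ->
    nrm (Ah h *m (P h v - Rh h v)) <= eps h * normZ v ;
  sd_eta : forall h, H h -> forall v, Z v ->
    nrm (P h v - Rh h v) <= eta h * normZ v ;
  sd_eps0 : eps h @[h --> within H 0^'+] --> (0 : R) ;
  sd_eta0 : eta h @[h --> within H 0^'+] --> (0 : R) ;
  sd_invC : exists C : R, forall h, H h ->
    (opnorm (fun v => (invmx (Ah h) *m Ch h v : 'cV[R[i]]_(N h)))
     <= C%:E)%E }.

End discretization.

(* One run of the explicit scheme with stepsize k; the (n+1)-st step is taken as
   long as t_{n+1} <= T, so that the data are only evaluated on [0, T]. *)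
Definition lawson_run (R : realType) (s : nat) (a : 'I_s -> 'I_s -> R)
    (b c : 'I_s -> R) (N : nat) (A : 'M[R[i]]_N) (F : R -> 'cV[R[i]]_N -> 'cV[R[i]]_N)
    (T k : R) (U0 : 'cV[R[i]]_N) (U : nat -> 'cV[R[i]]_N)
    (K : nat -> 'I_s -> 'cV[R[i]]_N) : Prop :=
  U 0%N = U0 /\
  forall n : nat, n.+1%:R * k <= T ->
    (forall i, K n i = expmx ((c i * k)%:C *: A) *m U n
       + k%:C *: \sum_(j < s | (j < i)%N) (a i j)%:C *:
           (expmx (((c i - c j) * k)%:C *: A) *m F (n%:R * k + c j * k) (K n j)))
    /\ U n.+1 = expmx (k%:C *: A) *m U n
       + k%:C *: \sum_(i < s) (b i)%:C *:
           (expmx (((1 - c i) * k)%:C *: A) *m F (n%:R * k + c i * k) (K n i)).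

(* f is C^1 on [0, T] x C^N and its derivative with respect to the variable in
   C^N is bounded, uniformly in h, on a neighbourhood [Nb h] of the solution
   containing the numerical approximation. No size uniform in h is imposed on
   the neighbourhood; it only has to be star-shaped about the solution, as balls
   are. *)
Definition bounded_derivative (R : realType) (d : nat) (Om : domain R d)
    (T : R) (u : R -> Ccl Om) (H : set R) (N : R -> nat)
    (node : forall h, 'I_(N h) -> closure Om)
    (fh : forall h, R -> 'cV[R[i]]_(N h) -> 'cV[R[i]]_(N h))
    (s : nat) (c : 'I_s -> R)
    (U : forall h, R -> nat -> 'cV[R[i]]_(N h))
    (K : forall h, R -> nat -> 'I_s -> 'cV[R[i]]_(N h)) : Prop :=
  exists (L : R) (Nb : forall h, R -> set 'cV[R[i]]_(N h)),
  forall h, H h ->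
  [/\ exists2 Dx, exists Dt, is_C1_with T (fh h) Dt Dx &
        forall t v, 0 <= t <= T -> Nb h t v -> (opnorm (Dx t v) <= L%:E)%E,
      forall t, 0 <= t <= T -> exists2 rho : R, 0 < rho &
        forall v, nrm (v - grid_values (@node h) (u t)) < rho -> Nb h t v,
      forall t v (r : R), 0 <= t <= T -> Nb h t v -> 0 <= r <= 1 ->
        Nb h t (grid_values (@node h) (u t)
                + r%:C *: (v - grid_values (@node h) (u t))),
      forall k n, 0 < k -> n%:R * k <= T -> Nb h (n%:R * k) (U h k n) &
      forall k n i, 0 < k -> n.+1%:R * k <= T ->
        Nb h (n%:R * k + c i * k) (K h k n i)].

(* Main.v *)
(* The numerical solution itself is bounded, and so is [P_h u]. Write
   [C_h g(t) = A w(t)] with [w = A^-1 C_h g], which is bounded and Lipschitz in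
   time uniformly in h. Since [c_i < 1], one step of the contribution of the
   boundary data, [k A e^((1 - c_i) k A) w], is bounded by the smoothing estimate;
   summed over the steps, it is handled by Abel summation against the bounded
   partial sums of [k A e^(r k A)]. The stages are bounded in the same way, since
   [c_j < c_i] for j < i. What remains is a one-step recursion whose
   right-hand side grows linearly in the solution because f is Lipschitz along the
   segments joining the stages to the exact solution, so Gronwall applies. *)

Require Import Defs.
From mathcomp Require Import all_boot all_order all_algebra.
From mathcomp Require Import all_classical all_reals all_analysis.
From mathcomp Require Import complex.
From mathcomp Require Import ring lra.

Set Implicit Arguments.
Unset Strict Implicit.
Unset Printing Implicit Defensive.

Import Order.TTheory GRing.Theory Num.Theory.
Import numFieldNormedType.Exports.

Local Open Scope classical_set_scope.
Local Open Scope ring_scope.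
Local Open Scope complex_scope.

(** * Norms, limits and series of complex matrices, entry by entry *)

Section entrywise.
Variable R : realType.
Implicit Types z w : R[i]^o.

Lemma nrmM z w : nrm (z * w : R[i]^o) = nrm z * nrm w.
Proof. exact: (@nrmZ R R[i]^o z w). Qed.

Lemma nrmC (x : R) : nrm (x%:C : R[i]^o) = `|x|.
Proof. by rewrite /nrm normc_def /= expr0n addr0 sqrtr_sqr. Qed.

Lemma nrm_sum (V : normedModType R[i]) (J : Type) (r : seq J) (P : pred J)
    (F : J -> V) :
  nrm (\sum_(j <- r | P j) F j) <= \sum_(j <- r | P j) nrm (F j).
Proof.
elim/big_rec2 : _ => [|j y x _ xy]; first by rewrite /nrm normr0.
exact: le_trans (nrmD _ _) (lerD _ xy).
Qed.

Lemma nrmZC (V : normedModType R[i]) (x : R) (v : V) :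
  nrm (x%:C *: v) = `|x| * nrm v.
Proof. by rewrite nrmZ -/(@nrm _ R[i]^o _) nrmC. Qed.

Lemma nrm0 (V : normedModType R[i]) : nrm (0 : V) = 0.
Proof. by rewrite /nrm normr0. Qed.

Lemma nrmN (V : normedModType R[i]) (v : V) : nrm (- v) = nrm v.
Proof. by rewrite /nrm normrN. Qed.

Lemma nrmB (V : normedModType R[i]) (v w : V) : nrm (v - w) = nrm (w - v).
Proof. by rewrite /nrm distrC. Qed.

Lemma cvg_sum (V : normedModType R[i]) (J : Type) (r : seq J)
    (w : J -> nat -> V) (l : J -> V) :
  (forall j, w j @ \oo --> l j) ->
  \sum_(j <- r) w j N @[N --> \oo] --> \sum_(j <- r) l j.
Proof.
move=> wl; elim: r => [|j r IH].
  by under eq_fun do rewrite big_nil; rewrite big_nil; exact: cvg_cst.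
by under eq_fun do rewrite big_cons; rewrite big_cons; exact: cvgD.
Qed.

Section mx.
Variables m n : nat.
Local Notation mat := ('M[R[i]]_(m, n) : normedModType R[i]).
Implicit Types A : mat.

Lemma nrm_entry A p q : nrm (A p q : R[i]^o) <= nrm A.
Proof.
rewrite -lecR -!nrmE [leRHS]/Num.Def.normr /= mx_normE.
by rewrite -[leLHS]nngE num_le; exact: (@le_bigmax _ _ _ _ (fun i => _) (p, q)).
Qed.

Lemma nrm_mx_le A (B : R) : 0 <= B ->
  (forall p q, nrm (A p q : R[i]^o) <= B) -> nrm A <= B.
Proof.
move=> B0 AB; rewrite /nrm.
have [|A0] := eqVneq (mx_norm A) 0; first by rewrite [`|A|]/Num.Def.normr /= => ->.
by have [[p q] /= Apq] := mx_norm_neq0 A0; rewrite [`|A|]/Num.Def.normr /= Apq AB.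
Qed.

(** There are finitely many entries, so [filter_forall] turns the entrywise eventual bounds into a
    simultaneous one. *)
Lemma cvg_mx_entry (F : set_system nat) (FF : Filter F)
    (M : nat -> mat) A :
  (forall p q, (M k p q : R[i]^o) @[k --> F] --> (A p q : R[i]^o)) ->
  M @ F --> A.
Proof.
move=> MA; apply/cvgrPdist_le => e e0.
have -> : e = (complex.Re e)%:C by rewrite RRe_real // gtr0_real.
have : \forall k \near F, forall pq : 'I_m * 'I_n,
    `|A pq.1 pq.2 - M k pq.1 pq.2 : R[i]^o| <= e.
  apply: filter_forall => -[p q] /=.
  by move/cvgrPdist_le : (MA p q) => /(_ _ e0).
apply: filterS => k Mk; rewrite nrmE lecR.
apply: nrm_mx_le => [|p q].
  by move: e0; rewrite ltcE => /andP[_ /ltW].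
by have := Mk (p, q); rewrite !mxE nrmE lecE => /andP[].
Qed.

Lemma cvg_entry (F : set_system nat) (FF : Filter F)
    (M : nat -> mat) A p q :
  M @ F --> A -> (M k p q : R[i]^o) @[k --> F] --> (A p q : R[i]^o).
Proof.
move=> /cvgrPdist_le MA; apply/cvgrPdist_le => e /MA; apply: filterS => k.
apply: le_trans; rewrite !nrmE lecR; have := nrm_entry (A - M k) p q.
by rewrite !mxE.
Qed.

Lemma cvg_complex (z : nat -> R[i]) (x y : R) :
  complex.Re (z k) @[k --> \oo] --> x -> complex.Im (z k) @[k --> \oo] --> y ->
  (z k : R[i]^o) @[k --> \oo] --> ((x +i* y)%C : R[i]^o).
Proof.
move=> zx zy; apply/cvgrPdist_le => e e0.
have -> : e = (complex.Re e)%:C by rewrite RRe_real // gtr0_real.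
have e20 : 0 < complex.Re e / 2.
  by rewrite divr_gt0 //; move: e0; rewrite ltcE => /andP[].
near=> k; rewrite nrmE lecR.
have -> : (x +i* y)%C - z k = (x - complex.Re (z k))%:C
    + 'i%C * (y - complex.Im (z k))%:C.
  by case: (z k) => ? ? /=; apply/eqP; rewrite eq_complex /=;
    rewrite !(mul0r, mul1r, subr0, addr0, mulr0, add0r, sub0r) !eqxx.
rewrite (splitr (complex.Re e)); apply: le_trans (nrmD _ _) _.
apply: lerD.
  by rewrite nrmC; near: k; move/cvgrPdist_le : zx => /(_ _ e20).
rewrite nrmM nrmC {1}/nrm normc_def /= expr0n add0r expr1n sqrtr1 mul1r.
by near: k; move/cvgrPdist_le : zy => /(_ _ e20).
Unshelve. all: by end_near. Qed.

(** Comparison test: the real and imaginary parts of each entry converge absolutely, and the limit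
    matrix is assembled from their limits. *)
Lemma is_cvg_series_mx (M : nat -> mat) (v : nat -> R) :
  (forall k p q, nrm (M k p q : R[i]^o) <= v k) -> cvgn (series v) ->
  cvgn (series M).
Proof.
move=> Mv cv.
(* Nonnegativity of [v] is read off an entry of [M], which exists only when both dimensions are
   positive. *)
have v0 k : (0 < m)%N -> (0 < n)%N -> 0 <= v k.
  move=> m0 n0.
  exact: le_trans (nrm_ge0 _) (Mv k (Ordinal m0) (Ordinal n0)).
have dom (P : R[i] -> R) : (forall z, `|P z| <= nrm (z : R[i]^o)) ->
    forall p q, cvgn (series (fun k => P (M k p q))).
  move=> Pz p q; apply: normed_cvg; apply: (series_le_cvg _ _ _ cv) => k //=.
  - apply: v0; [case: p => p|case: q => q]; exact: leq_ltn_trans.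
  - exact: le_trans (Pz _) (Mv _ _ _).
have ReM := dom (@complex.Re R).
have ImM := dom (@complex.Im R).
pose L : mat := \matrix_(p < m, q < n)
  (limn (series (fun k => complex.Re (M k p q))) +i*
   limn (series (fun k => complex.Im (M k p q))))%C.
suff : series M @ \oo --> L by move=> /cvgP.
apply: cvg_mx_entry => p q; rewrite mxE; apply: cvg_complex.
  rewrite (_ : (fun k => _) = series (fun k => complex.Re (M k p q))).
    by apply: ReM => z; rewrite -lecR -nrmE normc_ge_Re.
  by apply/funext => k; rewrite /series /= summxE raddf_sum.
rewrite (_ : (fun k => _) = series (fun k => complex.Im (M k p q))).
  apply: ImM => -[x y]; rewrite /nrm normc_def /= -[leLHS]sqrtr_sqr.
  by rewrite ler_sqrt ?lerDr ?sqr_ge0 // addr_ge0 ?sqr_ge0.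
by apply/funext => k; rewrite /series /= summxE raddf_sum.
Qed.

End mx.

Lemma cvg_mulmx_entry m n k (M1 : nat -> 'M[R[i]]_(m, n))
    (M2 : nat -> 'M[R[i]]_(n, k)) (A : 'M[R[i]]_(m, n)) (B : 'M[R[i]]_(n, k)) :
  (forall p q, (M1 N p q : R[i]^o) @[N --> \oo] --> (A p q : R[i]^o)) ->
  (forall p q, (M2 N p q : R[i]^o) @[N --> \oo] --> (B p q : R[i]^o)) ->
  forall p q, ((M1 N *m M2 N) p q : R[i]^o) @[N --> \oo] -->
    ((A *m B) p q : R[i]^o).
Proof.
move=> MA MB p q; under eq_fun do rewrite mxE; rewrite mxE.
apply: (@cvg_sum R[i]^o _ _ (fun r N => M1 N p r * M2 N r q : R[i]^o)
  (fun r => A p r * B r q : R[i]^o)) => r.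
exact: (@cvgM R[i]).
Qed.
End entrywise.

(** * The matrix exponential *)

(** The binomial theorem divided by [k!], reindexed over the triangle [i + j < n]. The vectors [v k]
    are left free so that the identity serves both the powers of a matrix and their scalar
    majorants. *)
Lemma exp_binomial (F : numFieldType) (V : lmodType F) (v : nat -> V) (x y : F) n :
  \sum_(0 <= k < n) ((x + y) ^+ k / k`!%:R) *: v k =
  \sum_(0 <= i < n) \sum_(0 <= j < n | (i + j < n)%N)
    (x ^+ i / i`!%:R * (y ^+ j / j`!%:R)) *: v (i + j)%N.
Proof.
have -> : \sum_(0 <= k < n) ((x + y) ^+ k / k`!%:R) *: v k =
    \sum_(0 <= k < n) \sum_(0 <= i < n | (i <= k)%N)
      (x ^+ i / i`!%:R * (y ^+ (k - i) / (k - i)`!%:R)) *: v k.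
  apply: eq_big_nat => k /andP[_ kn].
  have -> : \sum_(0 <= i < n | (i <= k)%N)
      (x ^+ i / i`!%:R * (y ^+ (k - i) / (k - i)`!%:R)) *: v k =
    \sum_(0 <= i < k.+1)
      (x ^+ i / i`!%:R * (y ^+ (k - i) / (k - i)`!%:R)) *: v k.
    by rewrite [RHS](big_nat_widen _ _ n).
  rewrite -scaler_suml; congr (_ *: _).
  rewrite big_mkord addrC exprDn mulr_suml; apply: eq_bigr => i _.
  have ik : (i <= k)%N by rewrite -ltnS.
  have fact0 (m : nat) : m`!%:R != 0 :> F by rewrite pnatr_eq0 -lt0n fact_gt0.
  rewrite -mulr_natl -(bin_fact ik) !natrM; field.
  by rewrite !fact0 /= pnatr_eq0 -lt0n bin_gt0.
rewrite (exchange_big_dep_nat xpredT) //=; apply: eq_big_nat => i /andP[_ i_n].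
have -> : \sum_(0 <= j < n | (i + j < n)%N)
    (x ^+ i / i`!%:R * (y ^+ j / j`!%:R)) *: v (i + j)%N =
  \sum_(0 <= j < n - i) (x ^+ i / i`!%:R * (y ^+ j / j`!%:R)) *: v (i + j)%N.
  by rewrite [RHS](big_nat_widen _ _ n) ?leq_subr //; apply: eq_bigl => j;
    rewrite ltn_subRL.
rewrite -(big_nat_widenl i 0 n xpredT) // -{1}(add0n i) big_addn.
by apply: eq_bigr => j _; rewrite addnK addnC.
Qed.

Section expmx_semigroup.
Variables (R : realType) (n : nat).
Local Notation mat := ('M[R[i]]_n : normedModType R[i]).
Implicit Types A : 'M[R[i]]_n.

(** A crude substitute for a submultiplicative norm: its powers dominate every entry of the powers
    of [A], which reduces the matrix exponential to the real one. *)
Definition entry_sum A : R := \sum_p \sum_q nrm (A p q : R[i]^o).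

Lemma nrm_exp_entry A k p q :
  nrm ((A ^+ k) p q : R[i]^o) <= entry_sum A ^+ k.
Proof.
have S0 : 0 <= entry_sum A.
  by apply: sumr_ge0 => ? _; apply: sumr_ge0 => ? _; exact: nrm_ge0.
elim: k p q => [|k IH] p q.
  rewrite !expr0 mxE; case: eqP => _; rewrite ?nrm0 ?ler01 //.
  by rewrite -[_ *+ _](rmorph1 (real_complex R)) nrmC normr1.
rewrite !exprS -mulmxE mxE; apply: le_trans (nrm_sum _ _ _) _.
apply: (@le_trans _ _ (\sum_r nrm (A p r : R[i]^o) * entry_sum A ^+ k)).
  by apply: ler_sum => r _; rewrite nrmM ler_wpM2l ?nrm_ge0.
rewrite -mulr_suml ler_wpM2r ?exprn_ge0 // /entry_sum [leRHS](bigD1 p) //= lerDl.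
by apply: sumr_ge0 => ? _; apply: sumr_ge0 => ? _; exact: nrm_ge0.
Qed.

Definition expmx_part A (t : R) (N : nat) : mat :=
  \sum_(0 <= k < N) (t%:C ^+ k / k`!%:R) *: A ^+ k.

Lemma exprZmx A (z : R[i]) k : (z *: A) ^+ k = z ^+ k *: A ^+ k.
Proof.
elim: k => [|k IH]; first by rewrite !expr0 scale1r.
by rewrite !exprS IH -!mulmxE -scalemxAl -scalemxAr scalerA.
Qed.

Lemma expmx_part_cvg A t :
  expmx_part A t @ \oo --> (expmx (t%:C *: A) : mat).
Proof.
have E : series (fun m => (m`!%:R)^-1 *: (t%:C *: A) ^+ m : mat) = expmx_part A t.
  apply/funext => N; apply: eq_bigr => k _.
  by rewrite exprZmx scalerA mulrC.
rewrite /expmx -[X in X @ _ --> _]E.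
apply: (@is_cvg_series_mx _ _ _ _ (exp_coeff (`|t| * entry_sum A))).
  move=> k p q; rewrite exprZmx scalerA mxE nrmM /exp_coeff /= exprMn.
  have -> : (k`!%:R : R[i])^-1 * t%:C ^+ k = (t ^+ k / k`!%:R)%:C.
    by rewrite rmorphM fmorphV rmorphXn /= rmorph_nat mulrC.
  rewrite nrmC normrM normfV normrX [`|k`!%:R|]normr_nat mulrAC.
  by rewrite ler_wpM2r ?invr_ge0 // ler_wpM2l ?exprn_ge0 // nrm_exp_entry.
exact: is_cvg_series_exp_coeff.
Qed.

Lemma expmx_part_cvg_entry A t p q :
  (expmx_part A t N p q : R[i]^o) @[N --> \oo] -->
  (expmx (t%:C *: A) p q : R[i]^o).
Proof.
have c : expmx_part A t @ \oo --> (expmx (t%:C *: A) : mat).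
  exact: expmx_part_cvg.
exact: (@cvg_entry R n n _ _ _ _ p q c).
Qed.

(* The terms A^(i+j) left over from the product are those with i + j >= N; their
   scalar majorants sum to the same defect for the real exponential series. *)
Lemma exp_part_tail A s t N p q : 0 <= s -> 0 <= t ->
  nrm ((expmx_part A s N *m expmx_part A t N - expmx_part A (s + t) N) p q
       : R[i]^o)
  <= series (exp_coeff (s * entry_sum A)) N * series (exp_coeff (t * entry_sum A)) N
     - series (exp_coeff ((s + t) * entry_sum A)) N.
Proof.
move=> s0 t0; set a := entry_sum A.
have a0 : 0 <= a.
  by apply: sumr_ge0 => ? _; apply: sumr_ge0 => ? _; exact: nrm_ge0.
have coefE (x : R) : series (exp_coeff (x * a)) N =
    \sum_(0 <= k < N) (x ^+ k / k`!%:R) *: (a ^+ k : R^o).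
  by apply: eq_bigr => k _; rewrite /exp_coeff /= exprMn mulrAC.
have -> : expmx_part A s N *m expmx_part A t N - expmx_part A (s + t) N =
   \sum_(0 <= i < N) \sum_(0 <= j < N | ~~ (i + j < N)%N)
     (s ^+ i / i`!%:R * (t ^+ j / j`!%:R))%:C *: A ^+ (i + j)%N.
  rewrite /expmx_part rmorphD (exp_binomial (fun k => A ^+ k)).
  rewrite mulmx_suml -sumrB; apply: eq_bigr => i _.
  rewrite mulmx_sumr (bigID (fun j => (i + j < N)%N)) /= addrAC.
  rewrite -sumrB big1 ?add0r => [|j _].
    apply: eq_bigr => j _.
    rewrite -scalemxAl -scalemxAr scalerA mulmxE -exprD; congr (_ *: _).
    by rewrite !rmorphM !fmorphV !rmorphXn /= !rmorph_nat.
  by rewrite -scalemxAl -scalemxAr scalerA mulmxE -exprD subrr.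
have -> : series (exp_coeff (s * a)) N * series (exp_coeff (t * a)) N
    - series (exp_coeff ((s + t) * a)) N =
   \sum_(0 <= i < N) \sum_(0 <= j < N | ~~ (i + j < N)%N)
     (s ^+ i / i`!%:R * (t ^+ j / j`!%:R)) * a ^+ (i + j).
  rewrite !coefE (exp_binomial (fun k => a ^+ k : R^o)).
  rewrite mulr_suml -sumrB; apply: eq_bigr => i _.
  rewrite mulr_sumr (bigID (fun j => (i + j < N)%N)) /= addrAC.
  rewrite -sumrB big1 ?add0r => [|j _]; last by rewrite /GRing.scale /= exprD; ring.
  by apply: eq_bigr => j _; rewrite /GRing.scale /= exprD; ring.
rewrite summxE; apply: le_trans (nrm_sum _ _ _) _; apply: ler_sum => i _.
rewrite summxE; apply: le_trans (nrm_sum _ _ _) _; apply: ler_sum => j _.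
rewrite mxE nrmM nrmC ger0_norm ?ler_wpM2l ?nrm_exp_entry //;
  by rewrite !(mulr_ge0, divr_ge0, exprn_ge0, invr_ge0, ler0n).
Qed.

(** The defect between the product of the partial sums and the partial sum at [s + t] is dominated
    by the same defect for the real exponential, which tends to zero by [expRD]. *)
Lemma expmxD A s t : 0 <= s -> 0 <= t ->
  expmx ((s + t)%:C *: A) = expmx (s%:C *: A) *m expmx (t%:C *: A).
Proof.
move=> s0 t0; apply/matrixP => p q; apply/eqP; rewrite -subr_eq0; apply/eqP.
set a := entry_sum A.
apply: (@nrm0_eq0 R R[i]^o); rewrite -opprB nrmN; apply/eqP.
rewrite eq_le nrm_ge0 andbT.
have tail0 : series (exp_coeff (s * a)) N * series (exp_coeff (t * a)) N
    - series (exp_coeff ((s + t) * a)) N @[N --> \oo] --> (0 : R).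
  have -> : (0 : R) = expR (s * a) * expR (t * a) - expR ((s + t) * a).
    by rewrite mulrDl expRD subrr.
  by apply: cvgB; [apply: cvgM|]; exact: is_cvg_series_exp_coeff.
pose z N : R[i]^o :=
  (expmx_part A s N *m expmx_part A t N) p q - expmx_part A (s + t) N p q.
pose l : R[i]^o := (expmx (s%:C *: A) *m expmx (t%:C *: A)) p q
  - (expmx ((s + t)%:C *: A)) p q.
have zl : z N @[N --> \oo] --> l.
  apply: (@cvgB _ R[i]^o); last exact: expmx_part_cvg_entry.
  by apply: cvg_mulmx_entry => *; exact: expmx_part_cvg_entry.
have lhs := cvg_comp _ _ zl (@nrm_continuous R R[i]^o l).
apply: ler_cvg_to lhs tail0 _; apply: nearW => N.
by have := exp_part_tail A N p q s0 t0; rewrite mxE [X in _ + X]mxE.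
Qed.

Lemma expmx_comm A t : A *m expmx (t%:C *: A) = expmx (t%:C *: A) *m A.
Proof.
apply/matrixP => p q.
have L : ((A *m expmx_part A t N) p q : R[i]^o) @[N --> \oo] -->
    ((A *m expmx (t%:C *: A)) p q : R[i]^o).
  apply: cvg_mulmx_entry => *; last exact: expmx_part_cvg_entry.
  exact: cvg_cst.
have L' : ((expmx_part A t N *m A) p q : R[i]^o) @[N --> \oo] -->
    ((expmx (t%:C *: A) *m A) p q : R[i]^o).
  apply: cvg_mulmx_entry => *; first exact: expmx_part_cvg_entry.
  exact: cvg_cst.
apply: (cvg_unique _ L); first exact: norm_hausdorff.
have comm N : A *m expmx_part A t N = expmx_part A t N *m A.
  rewrite mulmx_suml mulmx_sumr; apply: eq_bigr => k _.
  by rewrite -scalemxAl -scalemxAr mulmxE -exprS -exprSr.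
by rewrite /=; under eq_fun do rewrite comm.
Qed.

End expmx_semigroup.

(** * Mean value inequality and C^1 maps *)

Section intervals.
Variable R : realType.

(** Compactness through a supremum: let [m] be the supremum of the points that [P] reaches from [a].
    Locality at [m] first yields [P a m], then pushes past [m] unless [m = b]. In use, transitivity
    is the additivity of increments or the gluing of bounds. *)
Lemma interval_cover (a b : R) (P : R -> R -> Prop) : a <= b ->
  (forall x y z, P x y -> P y z -> P x z) ->
  (forall t, a <= t <= b -> exists2 e : R, 0 < e & forall s, a <= s <= b ->
     `|s - t| < e -> (s <= t -> P s t) /\ (t <= s -> P t s)) ->
  P a b.
Proof.
move=> ab Ptrans Ploc.
pose E := [set s | a <= s <= b /\ P a s].
have Ea : E a.
  split; first by rewrite lexx.
  (* Reflexivity at [a] comes from the local hypothesis with [s = t = a]. *)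
  have [|e e0 /(_ a)] := Ploc a; first by rewrite lexx.
  by rewrite lexx ab subrr normr0 => /(_ isT e0)[/(_ isT)].
have Eub : ubound E b by move=> s [/andP[]].
have supE : has_sup E by split; [exists a|exists b].
set m := sup E.
have am : a <= m by apply: ub_le_sup => //; exists b.
have mb : m <= b by apply: ge_sup => //; exists a.
have [|e e0 me] := Ploc m; first by rewrite am mb.
have [s Es ms] := sup_adherent e0 supE.
have sm : s <= m by apply: ub_le_sup => //; exists b.
have [/andP[as_ sb] Pas] := Es.
have Pam : P a m.
  apply: Ptrans Pas _; apply: (me _ _ _).1 => //; first by rewrite as_.
  by rewrite distrC ger0_norm ?subr_ge0 // ltrBlDr -ltrBlDl.
have [<-//|mb'] := eqVneq m b.
have {mb'} mb' : m < b by rewrite lt_neqAle mb'.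
(* A point reached strictly beyond [m] contradicts the supremum; half of [e] keeps it within the
   local radius. *)
pose r := Num.min b (m + e / 2).
have mr : m < r by rewrite lt_min mb' ltrDl divr_gt0.
have rb : r <= b by rewrite ge_min lexx.
have : r <= m.
  apply: ub_le_sup; first by exists b.
  split; first by rewrite rb (le_trans am (ltW mr)).
  apply: Ptrans Pam _; apply: (me _ _ _).2; last exact: ltW.
    by rewrite rb (le_trans am (ltW mr)).
  rewrite ger0_norm ?subr_ge0 ?(ltW mr) // ltrBlDl gt_min ltrD2l orbC.
  by rewrite ltr_pdivrMr // ltr_pMr // ltr1n.
by rewrite leNgt mr.
Qed.

Variable V : normedModType R[i].

(** A mean value inequality without integration: local slope bounds chain together by
    [interval_cover], since increments over adjacent intervals add up. *)
Lemma mean_value_le (phi : R -> V) (a b M : R) : a <= b ->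
  (forall t, a <= t <= b -> forall e : R, 0 < e -> exists2 r : R, 0 < r &
     forall s, a <= s <= b -> `|s - t| < r ->
       nrm (phi s - phi t) <= (M + e) * `|s - t|) ->
  nrm (phi b - phi a) <= M * (b - a).
Proof.
move=> ab philoc; apply/ler_addgt0Pr => e e0.
(* The [+ 1] keeps the denominator positive when [a = b]; the accumulated slack is at most [e]. *)
have ba1 : 0 < b - a + 1 by rewrite ltr_wpDl // subr_ge0.
have e'0 : 0 < e / (b - a + 1) by rewrite divr_gt0.
apply: (@le_trans _ _ ((M + e / (b - a + 1)) * (b - a))); last first.
  rewrite mulrDl lerD2l mulrAC ler_pdivrMr // ler_wpM2l ?(ltW e0) //.
  by rewrite lerDl.
apply: (@interval_cover a b
  (fun x y => nrm (phi y - phi x) <= (M + e / (b - a + 1)) * (y - x))) => //.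
  move=> x y z xy yz.
  have -> : phi z - phi x = (phi y - phi x) + (phi z - phi y).
    by rewrite [RHS]addrC addrA subrK.
  have -> : z - x = (y - x) + (z - y) by ring.
  rewrite mulrDr.
  by apply: le_trans (nrmD _ _) _; apply: lerD.
move=> t tab; have [r r0 rP] := philoc t tab _ e'0.
exists r => // s sab st; have := rP s sab st; split=> st'.
  by rewrite nrmB -(ger0_norm (x := t - s)) ?subr_ge0 // distrC.
by rewrite -(ger0_norm (x := s - t)) ?subr_ge0.
Qed.

Lemma bounded_of_locally_bounded (phi : R -> V) (a b : R) : a <= b ->
  (forall t, a <= t <= b -> exists (B r : R), 0 < r /\
     forall s, a <= s <= b -> `|s - t| < r -> nrm (phi s) <= B) ->
  exists2 B : R, 0 <= B & forall t, a <= t <= b -> nrm (phi t) <= B.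
Proof.
move=> ab loc.
have [B phiB] : exists B : R, forall s, a <= s <= b -> nrm (phi s) <= B.
  apply: (@interval_cover a b
    (fun x y => exists B : R, forall s, x <= s <= y -> nrm (phi s) <= B)) => //.
    move=> x y z [B1 xy] [B2 yz]; exists (Num.max B1 B2) => s /andP[xs sz].
    rewrite le_max; case: (leP s y) => sy; first by rewrite xy ?xs.
    by rewrite yz ?orbT // (ltW sy).
  move=> t tab; have [B [r [r0 rP]]] := loc t tab.
  exists r => // s /andP[as_ sb]; move: tab => /andP[at_ tb] st; split=> st'.
    exists B => q /andP[sq qt]; apply: rP.
      by rewrite (le_trans as_) ?(le_trans qt).
    apply: le_lt_trans st.
    by rewrite !(distrC _ t) !ger0_norm ?subr_ge0 // lerB.
  exists B => q /andP[tq qs]; apply: rP.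
    by rewrite (le_trans at_) ?(le_trans qs).
  by apply: le_lt_trans st; rewrite !ger0_norm ?subr_ge0 // lerB.
exists B => //; apply: le_trans (phiB a _); first exact: nrm_ge0.
by rewrite lexx.
Qed.

End intervals.

(** * Operator norms of real-homogeneous maps *)

Section operator_norm.
Variables (R : realType) (V W : normedModType R[i]).

Lemma opnorm_le (L : V -> W) (C : R) : (opnorm L <= C%:E)%E ->
  (forall (x : R) v, L (x%:C *: v) = x%:C *: L v) ->
  forall v, nrm (L v) <= C * nrm v.
Proof.
move=> LC Lhom v; have [v0|v0] := eqVneq (nrm v) 0.
  have -> : v = (0 : R)%:C *: v by rewrite (nrm0_eq0 v0) scaler0.
  by rewrite Lhom !scale0r !nrm0 mulr0.
have vgt0 : 0 < nrm v by rewrite lt_def v0 nrm_ge0.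
have /ereal_sup_ubound : [set (nrm (L x))%:E | x in [set x | nrm x <= 1]]
    (nrm (L ((nrm v)^-1%:C *: v)))%:E.
  exists ((nrm v)^-1%:C *: v) => //=.
  by rewrite nrmZC ger0_norm ?invr_ge0 ?nrm_ge0 // mulVf.
move=> /le_trans /(_ LC); rewrite lee_fin Lhom nrmZC.
by rewrite ger0_norm ?invr_ge0 ?nrm_ge0 // ler_pdivrMl // mulrC.
Qed.

Lemma opnorm_ge0 (L : V -> W) (C : R) : (opnorm L <= C%:E)%E -> 0 <= C.
Proof.
have /ereal_sup_ubound : [set (nrm (L x))%:E | x in [set x | nrm x <= 1]]
    (nrm (L 0))%:E by exists 0 => //=; rewrite nrm0.
by move=> /le_trans /[apply]; rewrite lee_fin; apply: le_trans; exact: nrm_ge0.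
Qed.

Lemma opnorm_fin (L : V -> W) : (opnorm L < +oo)%E ->
  exists C : R, (opnorm L <= C%:E)%E.
Proof.
case: (opnorm L) => [r _|//|_]; first by exists r.
by exists 0; rewrite leNye.
Qed.

End operator_norm.

(** * Lipschitz and boundedness consequences of C^1 regularity *)

Section C1.
Variables (R : realType) (T : R).

Lemma is_deriv_on_le (E : normedModType R[i]) (w dw : R -> E) :
  is_deriv_on T w dw -> forall t, 0 <= t <= T -> forall e : R, 0 < e ->
  exists2 r : R, 0 < r & forall s, 0 <= s <= T -> `|s - t| < r ->
    nrm (w s - w t) <= (nrm (dw t) + e) * `|s - t|.
Proof.
move=> wdw t tT e e0.
have eC : 0 < e%:C :> R[i] by rewrite ltcR.
have := wdw t; rewrite /= in_itv /= => /(_ tT) /cvgrPdist_lt /(_ _ eC).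
rewrite near_withinE /= => /nbhs_ballP[r /= r0 rP].
exists r => // s sT st.
(* The limit of the quotients is taken on a punctured neighbourhood, so [s = t] is treated apart. *)
have [->|s_t] := eqVneq s t; first by rewrite !subrr normr0 mulr0 nrm0.
have := rP s; rewrite /ball /= distrC => /(_ st s_t).
rewrite in_itv /= => /(_ sT); rewrite nrmE ltcR => /ltW st'.
have st0 : s - t != 0 by rewrite subr_eq0.
have -> : w s - w t = (s - t)%:C *: (((s - t)^-1)%:C *: (w s - w t)).
  by rewrite scalerA -rmorphM mulfV // rmorph1 scale1r.
rewrite nrmZC mulrC ler_wpM2r //.
set q := _ *: (w s - w t) in st' *.
have -> : q = dw t + (q - dw t) by rewrite addrC subrK.
by apply: le_trans (nrmD _ _) _; rewrite lerD2l nrmB.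
Qed.

(** A derivative continuous on [[0, T]] is locally bounded, hence bounded, and its bound is a
    Lipschitz constant by the mean value inequality. *)
Lemma C1_on_lipschitz (E : normedModType R[i]) (w : R -> E) : 0 <= T ->
  C1_on T w -> exists2 M : R, 0 <= M &
    forall s t, 0 <= s -> s <= t -> t <= T -> nrm (w t - w s) <= M * (t - s).
Proof.
move=> T0 [dw wdw /subspace_continuousP dwc].
have [|M M0 dwM] := @bounded_of_locally_bounded R E dw 0 T T0.
  move=> t tT; have := dwc t; rewrite /= in_itv /= => /(_ tT) /cvgrPdist_lt.
  have one : 0 < (1 : R)%:C :> R[i] by rewrite ltcR.
  move=> /(_ _ one); rewrite near_withinE /= => /nbhs_ballP[r /= r0 rP].
  exists (nrm (dw t) + 1), r; split=> // s sT st.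
  have := rP s; rewrite /ball /= distrC => /(_ st).
  rewrite in_itv /= => /(_ sT); rewrite nrmE ltcR => /ltW st'.
  have -> : dw s = dw t + (dw s - dw t) by rewrite addrC subrK.
  by apply: le_trans (nrmD _ _) _; rewrite lerD2l nrmB.
exists M => // s t s0 st tT; apply: mean_value_le => // q /andP[sq qt] e e0.
have qT : 0 <= q <= T by rewrite (le_trans s0) // (le_trans qt).
have [r r0 rP] := is_deriv_on_le wdw qT e0.
exists r => // p /andP[sp pt] pq.
apply: le_trans (rP p _ pq) _.
  by rewrite (le_trans s0) // (le_trans pt).
by rewrite ler_wpM2r // lerD2r dwM.
Qed.

Section frechet.
Variables (E F : normedModType R[i]) (f : R -> E -> F).
Variables (Dt : R -> E -> F) (Dx : R -> E -> E -> F).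
Hypothesis fC1 : is_C1_with T f Dt Dx.

Lemma C1_homogeneous (t : R) (x : E) : 0 <= t <= T ->
  forall (a : R) v, Dx t x (a%:C *: v) = a%:C *: Dx t x v.
Proof.
move=> tT a v; have It : `[0, T]%classic t by rewrite /= in_itv.
have D0 : Dx t x 0 = 0.
  have := C1_linear fC1 x It 1 0 0; rewrite scaler0 addr0 scale1r.
  by move=> /eqP; rewrite -subr_eq subrr => /eqP.
by rewrite -[a%:C *: v]addr0 (C1_linear fC1) // D0 addr0.
Qed.

(** Only the derivative at the base point enters: the Fréchet remainder is absorbed into the slack
    [e]. *)
Lemma C1_increment (t : R) (x : E) (C e : R) : 0 <= t <= T ->
  (opnorm (Dx t x) <= C%:E)%E -> 0 < e ->
  exists2 r : R, 0 < r & forall s y, 0 <= s <= T -> `|s - t| < r ->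
    nrm (y - x) < r ->
    nrm (f s y - f t x) <=
      (nrm (Dt t x) + e) * `|s - t| + (C + e) * nrm (y - x).
Proof.
move=> tT DC e0; have It : `[0, T]%classic t by rewrite /= in_itv.
have := C1_frechet fC1 x It e0; rewrite near_withinE /=.
move=> [[A B] /= [/nbhs_ballP[r1 /= r10 rA] /nbhs_ballP[r2 /= r20 rB]] AB].
(* Balls of [E] have radii in [R[i]]; a positive one is real. *)
have r2E : r2 = (complex.Re r2)%:C by rewrite RRe_real // gtr0_real.
have r2'0 : 0 < complex.Re r2 by rewrite -ltcR -r2E.
exists (Num.min r1 (complex.Re r2)); first by rewrite lt_min r10.
move=> s y sT; rewrite !lt_min => /andP[st _] /andP[_ yx].
have : (A `*` B) (s, y).
  split=> /=; first by apply: rA; rewrite /ball /= distrC.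
  by apply: rB; rewrite -ball_normE /= nrmE r2E ltcR nrmB.
move=> /AB /=; rewrite in_itv /= => /(_ (conj sT I)).
set D := (s - t)%:C *: _ + _ => fD.
have -> : f s y - f t x = (f s y - f t x - D) + D by rewrite subrK.
apply: le_trans (nrmD _ _) _; apply: le_trans (lerD fD (nrmD _ _)) _.
have := opnorm_le DC (C1_homogeneous x tT) (y - x).
rewrite nrmZC; nra.
Qed.

(** Mean value inequality for [r |-> f t (x + r (y - x))]: time is frozen, so a bound of [Dx] on the
    segment controls the slope. *)
Lemma C1_lipschitz_segment (t : R) (x y : E) (L : R) : 0 <= t <= T ->
  (forall r : R, 0 <= r <= 1 ->
     (opnorm (Dx t (x + r%:C *: (y - x))%R) <= L%:E)%E) ->
  nrm (f t y - f t x) <= L * nrm (y - x).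
Proof.
move=> tT DL; set d := y - x.
have := @mean_value_le R F (fun r => f t (x + r%:C *: d)) 0 1 (L * nrm d) ler01.
rewrite /= rmorph1 rmorph0 scale1r scale0r addr0 subr0 mulr1 [x + d]addrC subrK.
apply=> r r01 e e0.
have d1 : 0 < nrm d + 1 by rewrite ltr_wpDl ?nrm_ge0.
have e'0 : 0 < e / (nrm d + 1) by rewrite divr_gt0.
have [rho rho0 rhoP] := C1_increment tT (DL r r01) e'0.
exists (rho / (nrm d + 1)); first by rewrite divr_gt0.
move=> q q01 qr.
have dE : x + q%:C *: d - (x + r%:C *: d) = (q - r)%:C *: d.
  by rewrite opprD addrACA subrr add0r -scalerBl -rmorphB.
have := rhoP t (x + q%:C *: d) tT; rewrite subrr normr0 => /(_ rho0).
rewrite dE nrmZC mulr0 add0r => /(_ _)/le_trans; apply.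
  rewrite ltr_pdivlMr // in qr; apply: le_lt_trans qr.
  by rewrite ler_wpM2l // lerDl.
rewrite mulrA [(_ + _) * _ * _]mulrAC ler_wpM2r // mulrDl lerD2l.
by rewrite mulrAC ler_pdivrMr // ler_wpM2l ?(ltW e0) // lerDl.
Qed.

End frechet.

(** [C1_increment] bounds [f] near each point of the curve, the Lipschitz curve [w] stays near that
    point for a short time, and the local bounds glue together. *)
Lemma C1_map_bounded_along (E F : normedModType R[i]) (f : R -> E -> F)
    (w : R -> E) : 0 <= T -> C1_map T f -> C1_on T w ->
  exists2 B : R, 0 <= B & forall t, 0 <= t <= T -> nrm (f t (w t)) <= B.
Proof.
move=> T0 [Dt [Dx fC1]] wC1; have [M M0 wM] := C1_on_lipschitz T0 wC1.
apply: (@bounded_of_locally_bounded R F (fun t => f t (w t))) => // t tT.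
have It : `[0, T]%classic t by rewrite /= in_itv.
have [C DC] := opnorm_fin (C1_bounded fC1 (w t) It).
have [r r0 rP] := C1_increment fC1 tT DC ltr01.
have M1 : 0 < M + 1 by rewrite ltr_wpDl.
have ws s : 0 <= s <= T -> nrm (w s - w t) <= M * `|s - t|.
  move=> /andP[s0 sT]; move: tT => /andP[t0 tT].
  case: (leP s t) => st.
    by rewrite nrmB distrC ger0_norm ?subr_ge0 // wM.
  by rewrite ger0_norm ?subr_ge0 ?(ltW st) // wM // ltW.
(* Within the radius [r / (M + 1)] both [|s - t|] and the displacement of [w] stay below [r]. *)
exists (nrm (f t (w t)) + ((nrm (Dt t (w t)) + 1) * r + (C + 1) * r)),
  (r / (M + 1)); split; first by rewrite divr_gt0.
move=> s sT st; rewrite ltr_pdivlMr // in st.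
have st1 : `|s - t| < r.
  by apply: le_lt_trans st; rewrite ler_peMr // lerDr.
have wst : nrm (w s - w t) < r.
  apply: le_lt_trans (ws s sT) _; apply: le_lt_trans st.
  by rewrite mulrC ler_wpM2l // lerDl.
have -> : f s (w s) = f t (w t) + (f s (w s) - f t (w t)).
  by rewrite addrC subrK.
apply: le_trans (nrmD _ _) _; rewrite lerD2l.
apply: le_trans (rP s (w s) sT st1 wst) _.
have C0 := opnorm_ge0 DC.
by apply: lerD; rewrite ler_wpM2l ?addr_ge0 ?nrm_ge0 // ltW.
Qed.

End C1.

Lemma nrm_grid_values (R : realType) (d : nat) (Om : domain R d) (N : nat)
    (node : 'I_N -> closure Om) (v : Ccl Om) :
  nrm (grid_values node v) <= nrm v.
Proof.
apply: nrm_mx_le => [|p q]; first exact: nrm_ge0.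
by rewrite mxE; exact: nrm_le_sup.
Qed.

(** * Stability of the Lawson scheme *)

Section recursions.
Variable R : realType.

(** By induction [y n] is at most [(1 + k alpha)^n (y 0 + n k beta)]; then [1 + x <= exp x] and
    [n k <= T] remove [n] and [k]. *)
Lemma discrete_gronwall (y : nat -> R) (k T alpha beta : R) :
  0 <= k -> 0 <= T -> 0 <= alpha -> 0 <= beta -> 0 <= y 0%N ->
  (forall n, n.+1%:R * k <= T -> y n.+1 <= y n + k * (alpha * y n + beta)) ->
  forall n, n%:R * k <= T -> y n <= expR (alpha * T) * (y 0%N + T * beta).
Proof.
move=> k0 T0 al0 be0 y0 yS.
have step n : n%:R * k <= T ->
    y n <= (1 + k * alpha) ^+ n * (y 0%N + n%:R * k * beta).
  elim: n => [_|n IH nT]; first by rewrite expr0 mul0r mul0r addr0 mul1r.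
  have nT' : n%:R * k <= T.
    by apply: le_trans nT; rewrite ler_wpM2r // ler_nat.
  have q1 : 1 <= (1 + k * alpha) ^+ n.+1.
    by rewrite exprn_ege1 // lerDl mulr_ge0.
  apply: le_trans (yS n nT) _.
  have -> : y n + k * (alpha * y n + beta) = (1 + k * alpha) * y n + k * beta.
    by ring.
  apply: (@le_trans _ _ ((1 + k * alpha) ^+ n.+1 * (y 0%N + n%:R * k * beta)
      + (1 + k * alpha) ^+ n.+1 * (k * beta))).
    apply: lerD; last by rewrite ler_peMl // mulr_ge0.
    rewrite exprS -mulrA ler_wpM2l ?IH //.
    by rewrite addr_ge0 // mulr_ge0.
  by rewrite -mulrDr -[n.+1%:R]natr1 -addrA !mulrDl mul1r.
move=> n nT; apply: le_trans (step n nT) _; apply: ler_pM.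
- by rewrite exprn_ge0 // addr_ge0 // mulr_ge0.
- by rewrite addr_ge0 // !mulr_ge0.
- apply: (@le_trans _ _ (expR (k * alpha) ^+ n)).
    by rewrite lerXn2r ?nnegrE ?expR_ge0 ?expR_ge1Dx ?addr_ge0 ?mulr_ge0.
  by rewrite -expRM_natl ler_expR mulrA mulrC ler_wpM2l.
- by rewrite lerD2l ler_wpM2r.
Qed.

(** Explicitness: a stage sees only earlier ones, so each index costs at most one more factor
    [1 + q * al]. The power [s] makes the bound independent of [i]. *)
Lemma stage_recursion (s : nat) (a : 'I_s -> 'I_s -> R) (x : 'I_s -> R) (p q : R) :
  0 <= p -> 0 <= q ->
  (forall i, x i <= p + q * \sum_(j < s | (j < i)%N) `|a i j| * x j) ->
  forall i, x i <= p * (1 + q * \sum_i \sum_j `|a i j|) ^+ s.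
Proof.
move=> p0 q0 xS; set al := \sum_i _.
have al0 : 0 <= al by apply: sumr_ge0 => ? _; exact: sumr_ge0.
have r1 : 1 <= 1 + q * al by rewrite lerDl mulr_ge0.
have r0 : 0 <= 1 + q * al by exact: le_trans r1.
(* Strong induction on [i], through an auxiliary strict bound [n]. *)
have step n (i : 'I_s) : (i < n)%N -> x i <= p * (1 + q * al) ^+ i.+1.
  elim: n i => // n IH i; rewrite ltnS => i_n.
  apply: le_trans (xS i) _.
  apply: (@le_trans _ _ (p + q * (al * (p * (1 + q * al) ^+ i)))).
    rewrite lerD2l ler_wpM2l //.
    apply: (@le_trans _ _
      (\sum_(j < s | (j < i)%N) `|a i j| * (p * (1 + q * al) ^+ i))).
      apply: ler_sum => j ji; rewrite ler_wpM2l //.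
      apply: le_trans (IH j (leq_trans ji i_n)) _.
      by rewrite ler_wpM2l // ler_weXn2l.
    rewrite -mulr_suml ler_wpM2r ?mulr_ge0 ?exprn_ge0 //.
    rewrite /al [leRHS](bigD1 i) //=.
    rewrite -[leLHS]addr0 lerD //; last by apply: sumr_ge0 => ? _; exact: sumr_ge0.
    by rewrite [leRHS](bigID (fun j : 'I_s => (j < i)%N)) /= lerDl sumr_ge0.
  rewrite exprS.
  have : p <= p * (1 + q * al) ^+ i by rewrite ler_peMr // exprn_ege1.
  nra.
move=> i; apply: le_trans (step _ i (ltn_ord i)) _.
by rewrite ler_wpM2l // ler_weXn2l.
Qed.

End recursions.

(** * Abel summation of the boundary contribution *)

Section boundary_sum.
Variables (R : realType) (N : nat) (A : 'M[R[i]]_N).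
Variable E : R -> 'M[R[i]]_N.
Hypothesis ED : forall s t, 0 <= s -> 0 <= t -> E (s + t) = E s *m E t.
Hypothesis EC : forall t, A *m E t = E t *m A.
Variables (k T C C' : R).
Hypotheses (k0 : 0 < k) (C0 : 0 <= C).
Hypothesis contr : forall t, 0 <= t -> forall v : 'cV_N, nrm (E t *m v) <= nrm v.
Hypothesis smooth : forall t, 0 <= t ->
  forall v : 'cV_N, nrm (t%:C *: A *m E t *m v) <= C' * nrm v.
Hypothesis sums : forall n, n%:R * k <= T -> forall v : 'cV_N,
  nrm (k%:C *: A *m (\sum_(1 <= r < n) E (r%:R * k)) *m v) <= C * nrm v.

(** The smoothing estimate at time [theta * k], divided by [theta]: a fixed positive fraction of the
    step is enough to tame [k A]. *)
Lemma smoothing_step (theta : R) (v : 'cV_N) : 0 < theta ->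
  nrm (k%:C *: (E (theta * k) *m (A *m v))) <= C' / theta * nrm v.
Proof.
move=> th0; rewrite mulrAC ler_pdivlMr // mulrC.
have := @smooth (theta * k) (mulr_ge0 (ltW th0) (ltW k0)) v.
rewrite -scalemxAl EC -scalemxAl rmorphM -scalerA nrmZC.
by rewrite (gtr0_norm th0) mulmxA.
Qed.

Variables (w : nat -> 'cV[R[i]]_N) (W Lam : R).
Hypotheses (W0 : 0 <= W) (Lam0 : 0 <= Lam).
Hypothesis wW : forall n, n.+1%:R * k <= T -> nrm (w n) <= W.
Hypothesis wL : forall n, n.+2%:R * k <= T -> nrm (w n.+1 - w n) <= Lam * k.

Let D p : 'M[R[i]]_N := k%:C *: A *m (\sum_(1 <= r < p) E (r%:R * k)).
(** With the convention [w (-1) = 0] the increments telescope to [w n], and all but the first are of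
    size [k]. *)
Let d m : 'cV[R[i]]_N := w m - (if m is j.+1 then w j else 0).
(* Summation by parts of [\sum_(m < n) k A e^((n - m) k A) w_m]. *)
Let H n : 'cV[R[i]]_N := \sum_(0 <= m < n) D (n.+1 - m) *m d m.

Let sum_d n : \sum_(0 <= m < n.+1) d m = w n.
Proof.
elim: n => [|n IH]; first by rewrite big_nat1 /d subr0.
by rewrite big_nat_recr //= IH /d addrC subrK.
Qed.

(** [E k] shifts [r] to [r + 1], and the term [r = 1] is added. The recursion starts at [p = 1], as
    [D 1] is an empty sum. *)
Let DS p : (0 < p)%N -> D p.+1 = E k *m D p + k%:C *: A *m E k.
Proof.
move=> p0; rewrite /D big_ltn // mul1r addrC.
rewrite mulmxDr [in RHS]mulmxA -scalemxAr -EC scalemxAl -mulmxA.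
congr (_ *m _ + _); rewrite big_add1 /= mulmx_sumr; apply: eq_big_nat => r _.
have -> : r.+1%:R * k = k + r%:R * k by rewrite -nat1r mulrDl mul1r.
by rewrite ED ?mulr_ge0 ?(ltW k0).
Qed.

Let HS n : H n.+1 = E k *m H n + k%:C *: A *m E k *m w n.
Proof.
transitivity (\sum_(0 <= m < n.+1)
    (E k *m (D (n.+1 - m) *m d m) + k%:C *: A *m E k *m d m)).
  apply: eq_big_nat => m /andP[_ mn].
  by rewrite subSn ?leqW // DS ?subn_gt0 // mulmxDl -mulmxA.
rewrite big_split /= -!mulmx_sumr sum_d; congr (_ *m _ + _).
(* The new summand [m = n] carries [D 1 = 0], so [E k] acts on [H n] alone. *)
have D1 : D 1 = 0 by rewrite /D big_geq // mulmx0.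
by rewrite big_nat_recr //= subSnn D1 mul0mx addr0.
Qed.

(** The factors [D] are bounded by [C], and the increments sum to at most [W + Lam * T]: one initial
    value, then Lipschitz increments over a time of at most [T]. *)
Let H_le n : n.+1%:R * k <= T -> nrm (H n) <= C * (W + Lam * T).
Proof.
move=> nT.
have mT m p : (m <= p)%N -> p%:R * k <= T -> m%:R * k <= T.
  by move=> mp; apply: le_trans; rewrite ler_wpM2r ?ler_nat ?(ltW k0).
have dsum q : q%:R * k <= T ->
    \sum_(0 <= m < q) nrm (d m) <= W + q%:R * (Lam * k).
  elim: q => [_|q IH qT]; first by rewrite big_geq // mul0r addr0.
  rewrite big_nat_recr //= -[q.+1%:R]natr1 mulrDl mul1r addrA.
  case: q IH qT => [|q] IH qT.
    rewrite big_geq // add0r mul0r addr0 /d subr0.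
    by apply: le_trans (wW qT) _; rewrite lerDl mulr_ge0 // ltW.
  by apply: lerD; [apply: IH; exact: mT qT|exact: wL].
apply: le_trans (nrm_sum _ _ _) _.
apply: (@le_trans _ _ (\sum_(0 <= m < n) C * nrm (d m))).
  rewrite big_nat_cond [leRHS]big_nat_cond; apply: ler_sum => m _.
  by apply: sums; apply: mT nT; exact: leq_subr.
rewrite -mulr_sumr ler_wpM2l //; apply: le_trans (dsum n _) _.
  exact: mT nT.
rewrite lerD2l mulrCA ler_wpM2l //; exact: mT nT.
Qed.

Variables (theta : R) (G : nat -> 'cV[R[i]]_N).
Hypotheses (theta0 : 0 < theta) (G0 : G 0%N = 0).
Hypothesis GS : forall n, n.+1%:R * k <= T ->
  G n.+1 = E k *m G n + k%:C *: (E (theta * k) *m (A *m w n)).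

(** The latest datum is smoothed only during [theta * k] and falls to [smoothing_step]. Earlier data
    have also passed through whole steps: [E (theta * k)] commutes out of their sum and leaves
    [H]. *)
Lemma boundary_sum_le n : n%:R * k <= T ->
  nrm (G n) <= C * (W + Lam * T) + `|C'| / theta * W.
Proof.
move=> nT.
have tk : 0 <= theta * k by rewrite mulr_ge0 // ltW.
have T0 : 0 <= T by apply: le_trans nT; rewrite mulr_ge0 // ltW.
have Q0 : 0 <= `|C'| / theta by rewrite divr_ge0 // ltW.
case: n nT => [_|n nT].
  rewrite G0 nrm0; apply: addr_ge0; apply: mulr_ge0 => //.
  by rewrite addr_ge0 ?mulr_ge0.
have GE : G n.+1 = E (theta * k) *m H n + k%:C *: (E (theta * k) *m (A *m w n)).
  elim: n nT => [nT|n IH nT].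
    have H0 : H 0%N = 0 by rewrite /H big_geq.
    rewrite (GS nT) G0 H0.
    by rewrite !mulmx0.
  rewrite (GS nT) IH; last first.
    by apply: le_trans nT; rewrite ler_wpM2r ?ler_nat ?(ltW k0).
  have comm : E k *m E (theta * k) = E (theta * k) *m E k.
    by rewrite -ED ?(ltW k0) // addrC ED // ltW.
  congr (_ + _); rewrite HS !mulmxDr [in LHS]mulmxA comm -[in LHS]mulmxA.
  congr (_ + _); rewrite -[in LHS]scalemxAr; rewrite -!scalemxAl -!scalemxAr.
  by congr (_ *: _); rewrite EC (mulmxA (E k)) comm -!mulmxA.
rewrite GE; apply: le_trans (nrmD _ _) _; apply: lerD.
  by apply: le_trans (contr tk _) _; exact: H_le.
apply: le_trans (smoothing_step _ theta0) _.
apply: (@le_trans _ _ (`|C'| / theta * nrm (w n))).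
  by rewrite ler_wpM2r ?nrm_ge0 // ler_wpM2r ?ler_norm // invr_ge0 ltW.
by rewrite ler_wpM2l ?wW.
Qed.

End boundary_sum.

(** * Bounds for the stages and for the numerical solution *)

Section lawson_stability.
Variables (R : realType) (s : nat) (a : 'I_s -> 'I_s -> R) (b c : 'I_s -> R).
Variables (T C C' L M W Lam Ub : R).
Hypotheses (T0 : 0 <= T) (C0 : 0 <= C) (L0 : 0 <= L) (M0 : 0 <= M).
Hypotheses (W0 : 0 <= W) (Lam0 : 0 <= Lam).
Hypotheses (c01 : forall i, 0 <= c i <= 1) (c1 : forall i, c i != 1).
Hypothesis cmono : forall i j : 'I_s, (i < j)%N -> c i < c j.

Let theta i : R := 1 - c i.
Let theta_gt0 i : 0 < theta i.
Proof. by rewrite subr_gt0 lt_neqAle c1; case/andP: (c01 i). Qed.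

(* [Gb] bounds the contribution of the boundary data to the solution; [p0] that of
   the boundary data and of the affine part [M] of the growth of f to a stage. *)
Let Gb : R := \sum_i `|b i| * (C * (W + Lam * T) + `|C'| / theta i * W).
Let p0 : R := \sum_i \sum_j `|a i j| * (`|C'| / `|c i - c j| * W + T * M).
(** Amplification through the stages, from [stage_recursion] with [q = T * L]. *)
Let rho : R := (1 + T * L * \sum_i \sum_j `|a i j|) ^+ s.
Let bbar : R := \sum_i `|b i|.
Let alpha : R := bbar * (L * rho).
Let beta : R := bbar * (M + L * ((Gb + p0) * rho)).

(** The Gronwall bound of the solution freed of its boundary part, plus that part. It is built
    before the matrices and the stepsize are introduced, hence is the same for all [h], [k] and
    [n]. *)
Definition lawson_bound : R := expR (alpha * T) * (Ub + T * beta) + Gb.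

Let Gb0 : 0 <= Gb.
Proof.
apply: sumr_ge0 => i _; apply: mulr_ge0 => //.
apply: addr_ge0; apply: mulr_ge0 => //.
  by rewrite addr_ge0 ?mulr_ge0.
by rewrite divr_ge0 // ltW.
Qed.
(** True for all pairs, including [i = j], where the inverse of zero is zero; hence the full double
    sum [p0] dominates each sum over [j < i]. *)
Let stage_weight_ge0 i j : 0 <= `|a i j| * (`|C'| / `|c i - c j| * W + T * M).
Proof. by rewrite mulr_ge0 // addr_ge0 // mulr_ge0 // divr_ge0. Qed.
Let p00 : 0 <= p0.
Proof. by apply: sumr_ge0 => i _; exact: sumr_ge0. Qed.
Let bbar0 : 0 <= bbar. Proof. exact: sumr_ge0. Qed.
Let rho0 : 0 <= rho.
Proof.
rewrite exprn_ge0 // addr_ge0 // !mulr_ge0 //.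
by apply: sumr_ge0 => ? _; exact: sumr_ge0.
Qed.

Variables (N : nat) (A : 'M[R[i]]_N) (w : R -> 'cV[R[i]]_N).
Variable Phi : R -> 'cV[R[i]]_N -> 'cV[R[i]]_N.
Variables (k : R) (U : nat -> 'cV[R[i]]_N).
Variable K : nat -> 'I_s -> 'cV[R[i]]_N.
Variable E : R -> 'M[R[i]]_N.
Hypothesis ED : forall s t, 0 <= s -> 0 <= t -> E (s + t) = E s *m E t.
Hypothesis EC : forall t, A *m E t = E t *m A.
Hypothesis k0 : 0 < k.
Hypothesis contr : forall t, 0 <= t -> forall v : 'cV_N, nrm (E t *m v) <= nrm v.
Hypothesis smooth : forall t, 0 <= t ->
  forall v : 'cV_N, nrm (t%:C *: A *m E t *m v) <= C' * nrm v.
Hypothesis sums : forall n, n%:R * k <= T -> forall v : 'cV_N,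
  nrm (k%:C *: A *m (\sum_(1 <= r < n) E (r%:R * k)) *m v) <= C * nrm v.
Hypothesis wW : forall t, 0 <= t <= T -> nrm (w t) <= W.
Hypothesis wL : forall t r, 0 <= t -> t <= r -> r <= T ->
  nrm (w r - w t) <= Lam * (r - t).
Hypothesis run : forall n, n.+1%:R * k <= T ->
  (forall i, K n i = E (c i * k) *m U n
     + k%:C *: \sum_(j < s | (j < i)%N) (a i j)%:C *:
         (E ((c i - c j) * k) *m (A *m w (n%:R * k + c j * k)
                                  + Phi (n%:R * k + c j * k) (K n j)))) /\
  U n.+1 = E k *m U n + k%:C *: \sum_(i < s) (b i)%:C *:
    (E ((1 - c i) * k) *m (A *m w (n%:R * k + c i * k)
                           + Phi (n%:R * k + c i * k) (K n i))).
Hypothesis PhiM : forall n i, n.+1%:R * k <= T ->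
  nrm (Phi (n%:R * k + c i * k) (K n i)) <= M + L * nrm (K n i).
Hypothesis U0b : nrm (U 0%N) <= Ub.

Let time n i : n.+1%:R * k <= T -> 0 <= n%:R * k + c i * k <= T.
Proof.
move=> nT; have /andP[ci0 ci1] := c01 i.
rewrite addr_ge0 ?mulr_ge0 ?(ltW k0) //=; apply: le_trans nT.
by rewrite -[n.+1%:R]natr1 mulrDl lerD2l ler_wpM2r // ltW.
Qed.

Let kT n : n.+1%:R * k <= T -> k <= T.
Proof. by apply: le_trans; rewrite ler_peMl ?(ltW k0) // ler1n. Qed.

Lemma stage_le n i : n.+1%:R * k <= T -> nrm (K n i) <= (nrm (U n) + p0) * rho.
Proof.
move=> nT; have [KE _] := run nT.
apply: (@stage_recursion _ _ a (fun j => nrm (K n j)) (nrm (U n) + p0) (T * L))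
  => [||{}i]; [by rewrite addr_ge0 ?nrm_ge0|exact: mulr_ge0|].
have /andP[ci0 _] := c01 i.
rewrite KE; apply: le_trans (nrmD _ _) _; rewrite -addrA; apply: lerD.
  by apply: contr; rewrite mulr_ge0 // ltW.
rewrite scaler_sumr; apply: le_trans (nrm_sum _ _ _) _.
apply: (@le_trans _ _ (\sum_(j < s | (j < i)%N)
   (`|a i j| * (`|C'| / `|c i - c j| * W + T * M)
    + T * L * (`|a i j| * nrm (K n j))))).
  apply: ler_sum => j ji.
  (* Increasing nodes leave a positive smoothing time between an earlier stage and a later one. *)
  have cij : 0 < c i - c j by rewrite subr_gt0 cmono.
  rewrite scalerA mulrC -scalerA nrmZC [T * L * _]mulrCA -mulrDr ler_wpM2l //.
  rewrite mulmxDr scalerDr; apply: le_trans (nrmD _ _) _.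
  rewrite -addrA; apply: lerD.
    apply: le_trans (smoothing_step EC k0 smooth _ cij) _.
    rewrite (gtr0_norm cij).
    apply: (@le_trans _ _
      (`|C'| / (c i - c j) * nrm (w (n%:R * k + c j * k)))).
      by rewrite ler_wpM2r ?nrm_ge0 // ler_wpM2r ?ler_norm // invr_ge0 ltW.
    by rewrite ler_wpM2l ?wW ?time // divr_ge0 // ltW.
  (* In the contribution of [Phi] the factor [k] is replaced by [T], so that the constants do not
     depend on the stepsize. *)
  rewrite nrmZC (gtr0_norm k0) -mulrA -mulrDr.
  apply: ler_pM; [exact: ltW|exact: nrm_ge0|exact: kT nT|].
  by apply: le_trans (contr _ _) (PhiM _ nT); rewrite mulr_ge0 // ltW.
rewrite big_split /= -mulr_sumr lerD2r /p0 [leRHS](bigD1 i) //=.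
rewrite [X in _ <= X + _](bigID (fun j : 'I_s => (j < i)%N)) /= -addrA lerDl.
by rewrite addr_ge0 // sumr_ge0 // => l _; exact: sumr_ge0.
Qed.

(** The boundary data sampled at stage [i], propagated from zero. Separating the stages gives each
    sum a single smoothing time [theta i * k]. *)
Let G (i : 'I_s) : nat -> 'cV[R[i]]_N := fix rec m := if m is p.+1 then
  E k *m rec p + k%:C *: (E (theta i * k) *m (A *m w (p%:R * k + c i * k)))
  else 0.

Let G_le i n : n%:R * k <= T ->
  nrm (G i n) <= C * (W + Lam * T) + `|C'| / theta i * W.
Proof.
move=> nT; apply: (@boundary_sum_le R N A E ED EC k T C C' k0 C0 contr smooth sums
  (fun n => w (n%:R * k + c i * k)) W Lam W0 Lam0 _ _ (theta i) (G i)
  (theta_gt0 i) erefl _ n nT) => // m mT; first by rewrite wW ?time.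
have E1 : m.+1%:R * k + c i * k - (m%:R * k + c i * k) = k.
  by rewrite -natr1; ring.
rewrite -[in leRHS]E1; apply: wL.
- have /andP[ci0 _] := c01 i.
  by rewrite addr_ge0 ?mulr_ge0 ?(ltW k0).
- by rewrite lerD2r ler_wpM2r ?ler_nat ?(ltW k0).
- by have /andP[] := time i mT.
Qed.

Lemma lawson_stability n : n%:R * k <= T -> nrm (U n) <= lawson_bound.
Proof.
(* The terms [A *m w] cancel from the one-step recursion of [V], which leaves only the contribution
   of [Phi] for Gronwall. *)
pose V n := U n - \sum_i (b i)%:C *: G i n.
have sumG m : m%:R * k <= T -> nrm (\sum_i (b i)%:C *: G i m) <= Gb.
  move=> mT; apply: le_trans (nrm_sum _ _ _) _; apply: ler_sum => i _.
  by rewrite nrmZC ler_wpM2l ?G_le.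
have UV m : m%:R * k <= T -> nrm (U m) <= nrm (V m) + Gb.
  move=> mT; rewrite -[U m](subrK (\sum_i (b i)%:C *: G i m)).
  by apply: le_trans (nrmD _ _) _; rewrite lerD2l sumG.
have VS m : m.+1%:R * k <= T ->
    nrm (V m.+1) <= nrm (V m) + k * (alpha * nrm (V m) + beta).
  move=> mT; have [_ US] := run mT.
  have mT' : m%:R * k <= T.
    by apply: le_trans mT; rewrite ler_wpM2r ?ler_nat ?(ltW k0).
  pose w' i := E (theta i * k) *m (A *m w (m%:R * k + c i * k)).
  pose Phi' i := E (theta i * k) *m Phi (m%:R * k + c i * k) (K m i).
  have -> : V m.+1 = E k *m V m + k%:C *: \sum_i (b i)%:C *: Phi' i.
    have -> : V m.+1 = U m.+1 -
        \sum_i (b i)%:C *: (E k *m G i m + k%:C *: w' i) by [].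
    rewrite US /V mulmxBr -!addrA; congr (_ + _).
    rewrite mulmx_sumr !scaler_sumr -!sumrN -!big_split /=.
    apply: eq_bigr => i _; rewrite mulmxDr -/(w' i) -/(Phi' i).
    rewrite !scalerDr -scalemxAr !scalerA [k%:C * _]mulrC opprD.
    by rewrite addrC -!addrA; congr (_ + _); rewrite addrA addNr add0r.
  apply: le_trans (nrmD _ _) _; apply: lerD.
    by apply: contr; exact: ltW.
  rewrite nrmZC (gtr0_norm k0) ler_wpM2l ?(ltW k0) //.
  apply: le_trans (nrm_sum _ _ _) _.
  have -> : alpha * nrm (V m) + beta =
      bbar * (M + L * ((nrm (V m) + Gb + p0) * rho)).
    by rewrite /alpha /beta; ring.
  rewrite mulr_suml; apply: ler_sum => i _; rewrite nrmZC ler_wpM2l //.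
  apply: le_trans (contr _ _) _.
    by rewrite mulr_ge0 ?(ltW k0) ?(ltW (theta_gt0 i)).
  apply: le_trans (PhiM i mT) _; rewrite lerD2l ler_wpM2l //.
  apply: le_trans (stage_le i mT) _; rewrite ler_wpM2r // lerD2r.
  exact: UV.
move=> nT; apply: le_trans (UV n nT) _; rewrite lerD2r.
have alpha0 : 0 <= alpha by rewrite !mulr_ge0.
have beta0 : 0 <= beta.
  by rewrite mulr_ge0 // addr_ge0 // mulr_ge0 // mulr_ge0 // addr_ge0.
have V0 : V 0%N = U 0%N by rewrite /V big1 ?subr0 // => i _; rewrite /G scaler0.
apply: le_trans (discrete_gronwall (ltW k0) T0 alpha0 beta0 _ VS nT) _.
  exact: nrm_ge0.
by rewrite ler_wpM2l ?expR_ge0 // lerD2r V0.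
Qed.

End lawson_stability.

(** * Uniform bounds for the data, and the bounded global error *)

Theorem theorem5 (R : realType) (d : nat) (Om : domain R d)
    (Y : completeNormedModType R[i]) (T : R)
    (DA : set (Ccl Om)) (A : Ccl Om -> Ccl Om) (bd : Ccl Om -> Y)
    (f : R -> Ccl Om -> Ccl Om) (g : R -> Y) (u0 : Ccl Om) (u : R -> Ccl Om)
    (S : R -> Ccl Om -> Ccl Om)
    (H : set R) (N : R -> nat) (node : forall h, 'I_(N h) -> closure Om)
    (Ah : forall h, 'M[R[i]]_(N h))
    (Ch : forall h, {linear Y -> 'cV[R[i]]_(N h)})
    (fh : forall h, R -> 'cV[R[i]]_(N h) -> 'cV[R[i]]_(N h))
    (Rh : forall h, Ccl Om -> 'cV[R[i]]_(N h))
    (Z : set (Ccl Om)) (normZ : Ccl Om -> R) (eps eta : R -> R)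
    (s : nat) (a : 'I_s -> 'I_s -> R) (b c : 'I_s -> R)
    (U : forall h, R -> nat -> 'cV[R[i]]_(N h))
    (K : forall h, R -> nat -> 'I_s -> 'cV[R[i]]_(N h))
    (C' C h0 : R) :
  continuous_problem T DA A bd f g u0 u S ->
  space_discretization T DA A bd f S H node Ah Ch fh Rh Z normZ eps eta ->
  (forall i, 0 <= c i <= 1) ->
  (forall h, H h -> forall k, 0 < k ->
     lawson_run a b c (Ah h) (fun t v => Ch h (g t) + fh h t v) T k
       (grid_values (@node h) (u 0)) (U h k) (K h k)) ->
  bounded_derivative T u H node fh c U K ->
  (exists2 t, 0 <= t <= T & bd (u t) != 0) ->
  (forall i j : 'I_s, (i < j)%N -> c i < c j) ->
  (forall i, c i != 1) ->
  0 < h0 ->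
  (forall h, H h -> h <= h0 -> forall tau, 0 <= tau ->
     (mx_opnorm (tau%:C *: Ah h *m expmx (tau%:C *: Ah h)) <= C'%:E)%E) ->
  C2_on T u ->
  (forall h, H h -> h <= h0 -> forall (k : R) (n : nat), 0 < k -> n%:R * k <= T ->
     (mx_opnorm (k%:C *: Ah h *m
        \sum_(1 <= r < n) expmx ((r%:R * k)%:C *: Ah h)) <= C%:E)%E) ->
  exists B h1 : R, 0 < h1 /\
    forall h, H h -> h <= h1 -> forall (k : R) (n : nat), 0 < k -> n%:R * k <= T ->
      nrm (U h k n - grid_values (@node h) (u (n%:R * k))) <= B.
Proof.
move=> cp sd c01 run [L [Nb BD]] _ cmono c1 h0_gt0 smooth _ sums.
have T0 : 0 <= T := ltW (cp_T cp).
have [Mg Mg0 gL] := C1_on_lipschitz T0 (cp_g_C1 cp).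
have [Mu Mu0 uL] := C1_on_lipschitz T0 (cp_u_C1 cp).
have [Bf Bf0 fB] := C1_map_bounded_along T0 (cp_f_C1 cp) (cp_u_C1 cp).
have [Ci invC] := sd_invC sd.
have lip_bound (E : normedModType R[i]) (q : R -> E) (B : R) : 0 <= B ->
    (forall x y, 0 <= x -> x <= y -> y <= T -> nrm (q y - q x) <= B * (y - x)) ->
    forall t, 0 <= t <= T -> nrm (q t) <= nrm (q 0) + B * T.
  move=> B0 qB t /andP[t0 tT].
  have -> : q t = q 0 + (q t - q 0) by rewrite addrC subrK.
  apply: le_trans (nrmD _ _) _; rewrite lerD2l.
  apply: le_trans (qB 0 t _ t0 tT) _ => //.
  by rewrite ler_wpM2l // subr0.
have uB := lip_bound _ u Mu Mu0 uL; set Bu := nrm (u 0) + Mu * T in uB.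
have gB := lip_bound _ g Mg Mg0 gL; set Bg := nrm (g 0) + Mg * T in gB.
have Bu0 : 0 <= Bu by rewrite addr_ge0 ?nrm_ge0 ?mulr_ge0.
have Bg0 : 0 <= Bg by rewrite addr_ge0 ?nrm_ge0 ?mulr_ge0.
(* [W] and [Lam] are [|Ci|] times the bound and the Lipschitz constant of [g]; [Bf + |L| * Bu] comes
   from comparing [fh] at a stage with its value at the exact solution; the last [Bu] pays for the
   grid values of [u]. Absolute values supply nonnegativity. *)
exists (lawson_bound a b c T `|C| C' `|L| (Bf + `|L| * Bu) (`|Ci| * Bg)
  (`|Ci| * Mg) (nrm (u 0)) + Bu), h0; split=> // h Hh hh0 k n k0 nT.
have [[Dx [Dt fhC1] DxL] _ star _ KNb] := BD h Hh.
have nT' : 0 <= n%:R * k <= T.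
  by rewrite nT andbT; apply: mulr_ge0; [exact: ler0n|exact: ltW].
apply: le_trans (nrmD _ _) _; rewrite nrmN; apply: lerD; last first.
  exact: le_trans (nrm_grid_values _ _) (uB _ nT').
have unitA := sd_unit sd Hh.
pose w t : 'cV[R[i]]_(N h) := invmx (Ah h) *m Ch h (g t).
have FE : (fun t v => Ch h (g t) + fh h t v) =
    (fun t v => Ah h *m w t + fh h t v).
  by apply/funext => t; apply/funext => v; rewrite /w mulmxA mulmxV // mul1mx.
have := run h Hh k k0; rewrite FE => -[Ustart runU].
have invCv (v : Y) : nrm (invmx (Ah h) *m Ch h v : 'cV_(N h)) <= `|Ci| * nrm v.
  apply: le_trans (opnorm_le (invC h Hh) _ v) _.
    by move=> x y; rewrite linearZ /= -scalemxAr.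
  by rewrite ler_wpM2r ?nrm_ge0 ?ler_norm.
have linmx (M : 'M[R[i]]_(N h)) (x : R) (v : 'cV_(N h)) :
    M *m (x%:C *: v) = x%:C *: (M *m v) by rewrite -scalemxAr.
apply: (@lawson_stability R s a b c T `|C| C' `|L| (Bf + `|L| * Bu)
  (`|Ci| * Bg) (`|Ci| * Mg) (nrm (u 0)) T0 _ _ _ _ _ c01 c1 cmono (N h) (Ah h)
  w (fh h) k (U h k) (K h k) (fun t => expmx (t%:C *: Ah h)) _ _ k0 _ _ _ _ _
  runU _ _ n nT) => //.
- by rewrite addr_ge0 ?mulr_ge0.
- by rewrite mulr_ge0.
- by rewrite mulr_ge0.
- exact: expmxD.
- exact: expmx_comm.
- move=> t t0 v; rewrite -[leRHS]mul1r.
  exact: opnorm_le (sd_contractive sd Hh t0) (linmx _) v.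
- move=> t t0 v; exact: opnorm_le (smooth h Hh hh0 t t0) (linmx _) v.
- move=> m mT v.
  apply: le_trans (opnorm_le (sums h Hh hh0 k m k0 mT) (linmx _) v) _.
  by rewrite ler_wpM2r ?nrm_ge0 ?ler_norm.
- move=> t tT; apply: le_trans (invCv _) _.
  by rewrite ler_wpM2l ?gB.
- move=> t r t0 tr rT; rewrite /w -mulmxBr -linearB.
  by apply: le_trans (invCv _) _; rewrite -mulrA ler_wpM2l ?gL.
- move=> m i mT; set t := _ + _; set v := K h k m i.
  have tT : 0 <= t <= T.
    have /andP[ci0 ci1] := c01 i.
    rewrite /t addr_ge0 ?mulr_ge0 ?(ltW k0) //=; apply: le_trans mT.
    by rewrite -[m.+1%:R]natr1 mulrDl lerD2l ler_wpM2r // ltW.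
  have It : `[0, T]%classic t by rewrite /= in_itv.
  (* Pivot at the exact solution, where [fh] takes the grid values of [f t (u t)] and is bounded by
     [Bf] for every [h]. *)
  set p := grid_values (@node h) (u t).
  have -> : fh h t v = fh h t p + (fh h t v - fh h t p) by rewrite addrC subrK.
  have pBu : nrm p <= Bu by exact: le_trans (nrm_grid_values _ _) (uB _ tT).
  apply: le_trans (nrmD _ _) _; rewrite -addrA; apply: lerD.
    rewrite /p -(sd_f sd Hh _ It).
    exact: le_trans (nrm_grid_values _ _) (fB _ tT).
  (* [Nb] contains the stage and is star-shaped about [p], so the derivative bound holds on the
     whole segment. *)
  have vL : nrm (fh h t v - fh h t p) <= L * nrm (v - p).
    apply: (C1_lipschitz_segment fhC1 tT) => r r01.
    by apply: DxL => //; apply: star => //; exact: KNb.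
  apply: le_trans vL _; rewrite -mulrDr.
  apply: (@le_trans _ _ (`|L| * nrm (v - p))).
    by rewrite ler_wpM2r ?nrm_ge0 ?ler_norm.
  rewrite ler_wpM2l // addrC; apply: le_trans (nrmD _ _) _.
  by rewrite nrmN lerD2r.
- by rewrite Ustart nrm_grid_values.
Qed.
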